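(* The sharp $\mathcal{S}^*_{\mathfrak{B}}$-radii for the classes $\mathcal{S}^*_L(\alpha)$ and $\mathcal{S}^*_e(\alpha)$ are given by: (i) $R_{\mathcal{S}^*_{\mathfrak{B}}}(\mathcal{S}^*_L(\alpha))=1-\left(\frac{\sqrt{2/(1+e^2)}-\alpha}{1-\alpha}\right)^2$, where $\alpha\in\left[0,\,1-e/\sqrt{2(1+e^2)}\right)$. (ii) $R_{\mathcal{S}^*_{\mathfrak{B}}}(\mathcal{S}^*_e(\alpha))=\log\left(\frac{e\sqrt{2/(1+e^2)}-\alpha}{1-\alpha}\right)$, where $\alpha\in[0,1)$.
   Context: $\mathbb{D}$ is the open unit disk. $\mathcal{A}$ is the class of analytic functions $f$ in $\mathbb{D}$ with $f(z)=z+\sum_{n\ge2}a_nz^n$, and $\mathcal{S}\subset\mathcal{A}$ is the subclass of univalent functions. $f\prec g$ (subordination) means $f=g\circ w$ for some analytic $w:\mathbb{D}\to\mathbb{D}$ with $w(0)=0$. For $\psi$ analytic in $\mathbb{D}$ with $\psi(0)=1$, $\mathcal{S}^*(\psi)=\{f\in\mathcal{S}: zf'(z)/f(z)\prec\psi(z)\}$. $\mathfrak{B}(z)=\sqrt{1+\tanh z}$, and $\mathcal{S}^*_{\mathfrak{B}}=\mathcal{S}^*(\mathfrak{B})$. For $\alpha\in[0,1)$, $\mathcal{S}^*_L(\alpha)=\mathcal{S}^*(\alpha+(1-\alpha)\sqrt{1+z})$ and $\mathcal{S}^*_e(\alpha)=\mathcal{S}^*(\alpha+(1-\alpha)e^z)$.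 Square roots are principal branches. For a class $\mathcal{G}\subset\mathcal{A}$, the (sharp) $\mathcal{S}^*_{\mathfrak{B}}$-radius $R_{\mathcal{S}^*_{\mathfrak{B}}}(\mathcal{G})$ is the largest $R\in(0,1]$ such that for every $f\in\mathcal{G}$ and every $0<r\le R$ the function $z\mapsto f(rz)/r$ belongs to $\mathcal{S}^*_{\mathfrak{B}}$.
   Formalization: In (ii) the radius is stated as min{1, log(...)}: radii lie in (0,1] by definition, but the printed logarithm exceeds 1 for α near 1 (e.g. about 1.45 at α=0.9); whenever the logarithm is at most 1 the formula is the printed one. *)

(* Defs.v *)
From Stdlib Require Import Reals Lra.
From Coquelicot Require Import Coquelicot.
Open Scope R_scope.

Definition in_disk (z : C) : Prop := Cmod z < 1.

Definition Cexp (z : C) : C := (exp (Re z) * cos (Im z), exp (Re z) * sin (Im z)).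

Definition Ctanh (z : C) : C :=
  ((Cexp z - Cexp (- z)) / (Cexp z + Cexp (- z)))%C.

(* Principal branch: argument in (-PI/2, PI/2]; see [Csqrt_spec]. *)
Definition Csqrt (z : C) : C :=
  (sqrt ((Cmod z + Re z) / 2),
   (if Rlt_dec (Im z) 0 then -1 else 1) * sqrt ((Cmod z - Re z) / 2)).

Lemma Csqrt_spec (z : C) :
  (Csqrt z * Csqrt z)%C = z /\
  (0 < Re (Csqrt z) \/ (Re (Csqrt z) = 0 /\ 0 <= Im (Csqrt z))).
Proof.
destruct z as [x y].
assert (Hm : Cmod (x, y) * Cmod (x, y) = x * x + y * y).
{ unfold Cmod; simpl fst; simpl snd; rewrite sqrt_sqrt; nra. }
pose proof (Cmod_ge_0 (x, y)) as H0.
unfold Csqrt, Cmult, Re, Im; simpl fst; simpl snd.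
set (m := Cmod (x, y)) in *.
assert (Hp : 0 <= (m + x) / 2) by nra.
assert (Hq : 0 <= (m - x) / 2) by nra.
assert (Hy : sqrt ((m + x) / 2) * sqrt ((m - x) / 2) = Rabs y / 2).
{ rewrite <- sqrt_mult by assumption.
  replace ((m + x) / 2 * ((m - x) / 2)) with (Rsqr (y / 2)) by (unfold Rsqr; nra).
  rewrite sqrt_Rsqr_abs, Rabs_div, (Rabs_right 2); lra. }
pose proof (sqrt_sqrt _ Hp) as Hpp; pose proof (sqrt_sqrt _ Hq) as Hqq.
pose proof (sqrt_pos ((m + x) / 2)) as Hp0.
pose proof (sqrt_pos ((m - x) / 2)) as Hq0.
set (u := sqrt ((m + x) / 2)) in *; set (v := sqrt ((m - x) / 2)) in *.
destruct (Rlt_dec y 0) as [Hn | Hn].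
- rewrite Rabs_left in Hy by assumption.
  split; [apply injective_projections; simpl; nra | left; nra].
- rewrite Rabs_right in Hy by lra.
  split; [apply injective_projections; simpl; nra |].
  destruct (Rle_lt_or_eq_dec _ _ Hp0); [left | right]; lra.
Qed.

Definition analytic_on_disk (f : C -> C) : Prop :=
  forall z : C, in_disk z -> ex_derive f z.

Definition classA (f : C -> C) : Prop :=
  analytic_on_disk f /\
  exists a : nat -> C, a 0%nat = RtoC 0 /\ a 1%nat = RtoC 1 /\
    forall z : C, in_disk z -> is_pseries a z (f z).

Definition classS (f : C -> C) : Prop :=
  classA f /\
  forall z1 z2 : C, in_disk z1 -> in_disk z2 -> f z1 = f z2 -> z1 = z2.

Definition subordinate (f g : C -> C) : Prop :=
  exists w : C -> C,
    analytic_on_disk w /\ (forall z : C, in_disk z -> in_disk (w z)) /\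
    w (RtoC 0) = RtoC 0 /\
    forall z : C, in_disk z -> f z = g (w z).

(* z f'(z) / f(z), extended by its limit 1 at the removable singularity 0. *)
Definition starlike_quotient (f : C -> C) (z : C) : C :=
  if Ceq_dec z (RtoC 0) then RtoC 1 else (z * C_derive f z / f z)%C.

Definition Sstar (psi : C -> C) (f : C -> C) : Prop :=
  classS f /\ subordinate (starlike_quotient f) psi.

Definition Bfun (z : C) : C := Csqrt (1 + Ctanh z)%C.

Definition SstarB : (C -> C) -> Prop := Sstar Bfun.

Definition SstarL (alpha : R) : (C -> C) -> Prop :=
  Sstar (fun z : C => (alpha + (1 - alpha) * Csqrt (1 + z))%C).

Definition Sstare (alpha : R) : (C -> C) -> Prop :=
  Sstar (fun z : C => (alpha + (1 - alpha) * Cexp z)%C).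

Definition dilation (r : R) (f : C -> C) : C -> C :=
  fun z : C => (f (r * z) / r)%C.

Definition admissible_radius (G : (C -> C) -> Prop) (rho : R) : Prop :=
  0 < rho <= 1 /\
  forall f : C -> C, G f -> forall r : R, 0 < r <= rho -> SstarB (dilation r f).

(* rho is the largest admissible radius; in particular rho <= 1. *)
Definition is_SstarB_radius (G : (C -> C) -> Prop) (rho : R) : Prop :=
  admissible_radius G rho /\
  forall rho' : R, admissible_radius G rho' -> rho' <= rho.

(* Main.v *)
(** If T = q^2 - 1 lies in the disk |T| < tanh 1 and Re q > 0, then q = B(artanh T), and |artanh T| <= artanh |T| < 1
    by integration of artanh' along a ray; the values -tanh 1 and tanh 1 of T are attained by no point of
    B(D).  So for both classes it suffices to see that the image of the disk of the announced radius satisfies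
    |q^2 - 1| < tanh 1, and that the bound is attained on its boundary: at -rho for the lemniscate class, at rho for the
    exponential class.

    Membership of a dilation then follows from the Schwarz lemma for the subordinating function w.  It can be recovered
    from the starlike quotient z f'/f, so its derivative is continuous, and Cauchy's formula is available in the
    elementary form where one differentiates the integral of g(z + t (c - z)) c / (c - z) over the circle in t.
    For sharpness one takes f = z exp h with z h' = psi - 1.  Its univalence is seen in the coordinate s = log z:
    s + h(exp s) has derivative psi(exp s), of positive real part on the half-plane Re s < 0. *)
Require Import Defs.
From Stdlib Require Import Reals Lra Lia Psatz.
From Coquelicot Require Import Coquelicot.
Open Scope R_scope.

(** * Complex continuity and differentiability *)

(** Since B(v)^2 = 1 + tanh v, the endpoint values are B(-1) = sqrt (2 / (1 + e^2)) and B(1) = e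
    B(-1). The radii are the roots of alpha + (1 - alpha) sqrt (1 - rho) = B(-1) and of alpha + (1 -
    alpha) e^rho = B(1). The second root exceeds 1 when alpha is close to 1, whence the minimum with
    1 in the statement.

    The obstacle is regularity: the function w of a subordination is only differentiable at each
    point, whereas the Schwarz lemma rests on a Taylor expansion, and only f comes with a power
    series. Recovering w uses no branch of an inverse of psi: the lemniscate psi is undone by
    squaring, and for the exponential one the derivative of exp w is divided by exp w.

    Contour integrals are pairs of real integrals over [0, 2 pi]. Estimating the two components
    separately costs a factor 2, which is harmless: it only meets quantities of the form q^n, where
    n can be taken large. *)

Definition Ccontinuous {T : UniformSpace} (F : T -> C) (x : T) : Prop :=
  continuous (fun y => Re (F y)) x /\ continuous (fun y => Im (F y)) x.

Section ComplexContinuity.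
Context {T : UniformSpace}.
Implicit Types (F G : T -> C) (x : T).

Lemma Ccontinuous_ext_loc F G x : locally x (fun y => F y = G y) -> Ccontinuous F x -> Ccontinuous G x.
Proof.
intros H [H1 H2]; split; [apply continuous_ext_loc with (2 := H1) | apply continuous_ext_loc with (2 := H2)];
  apply filter_imp with (2 := H); intros y ->; reflexivity.
Qed.

Lemma Ccontinuous_const (c : C) x : Ccontinuous (fun _ => c) x.
Proof. split; apply continuous_const. Qed.

Lemma Ccontinuous_plus F G x : Ccontinuous F x -> Ccontinuous G x -> Ccontinuous (fun y => F y + G y)%C x.
Proof.
intros [A B] [A' B']; split.
- apply (continuous_plus (fun y => Re (F y)) (fun y => Re (G y))); assumption.
- apply (continuous_plus (fun y => Im (F y)) (fun y => Im (G y))); assumption.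
Qed.

Lemma Ccontinuous_mult F G x : Ccontinuous F x -> Ccontinuous G x -> Ccontinuous (fun y => F y * G y)%C x.
Proof.
intros [A B] [A' B']; split.
- apply (continuous_minus (fun y => Re (F y) * Re (G y)) (fun y => Im (F y) * Im (G y)));
  apply (continuous_mult (K := R_AbsRing)); assumption.
- apply (continuous_plus (fun y => Re (F y) * Im (G y)) (fun y => Im (F y) * Re (G y)));
  apply (continuous_mult (K := R_AbsRing)); assumption.
Qed.

Lemma Ccontinuous_opp F x : Ccontinuous F x -> Ccontinuous (fun y => - F y)%C x.
Proof.
intros [A B]; split; apply (continuous_opp (V := R_NormedModule)); assumption.
Qed.

Lemma Ccontinuous_minus F G x : Ccontinuous F x -> Ccontinuous G x -> Ccontinuous (fun y => F y - G y)%C x.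
Proof. intros A B; apply Ccontinuous_plus, Ccontinuous_opp; assumption. Qed.

Lemma continuous_inv_fun (f : T -> R) x : continuous f x -> f x <> 0 -> continuous (fun y => / f y) x.
Proof.
intros A B; apply (continuous_comp f Rinv); [exact A | apply continuous_Rinv, B].
Qed.

Lemma Ccontinuous_inv F x : Ccontinuous F x -> F x <> 0 -> Ccontinuous (fun y => / F y)%C x.
Proof.
intros [A B] H.
assert (N : continuous (fun y => / (Re (F y) ^ 2 + Im (F y) ^ 2)) x).
{ apply (continuous_inv_fun (fun y => Re (F y) ^ 2 + Im (F y) ^ 2)).
  - apply (continuous_plus (fun y => Re (F y) ^ 2) (fun y => Im (F y) ^ 2));
    repeat apply (continuous_mult (K := R_AbsRing)); try assumption; apply continuous_const.
  - intros E; apply H; destruct (F x) as [a b]; unfold Re, Im in E; simpl in E.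
    assert (a = 0) by nra; assert (b = 0) by nra; subst; reflexivity. }
split.
- apply (continuous_mult (K := R_AbsRing) (fun y => Re (F y))); assumption.
- apply (continuous_mult (K := R_AbsRing) (fun y => - Im (F y))); [| assumption].
  apply (continuous_opp (V := R_NormedModule)); assumption.
Qed.

(** The uniform structure on C is a product, so this is the composition of a function of two real
    variables with the pair (Re F, Im F). *)
Lemma Ccontinuous_comp (g : C -> C) F x : Ccontinuous F x -> Ccontinuous (T := C_UniformSpace) g (F x) -> Ccontinuous (fun y => g (F y)) x.
Proof.
intros [A B] [G1 G2]; split.
- apply continuous_ext with (f := fun y => Re (g (Re (F y), Im (F y)))).
  { intros y; rewrite <- surjective_pairing; reflexivity. }
  apply (continuous_comp_2 (U := T) (V := R_UniformSpace) (W := R_UniformSpace) (X := R_UniformSpace)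
    (fun y => Re (F y)) (fun y => Im (F y)) (fun a b => Re (g (a, b)))); try assumption.
  apply continuous_ext with (f := fun y : C => Re (g y)).
  { intros y; simpl; rewrite <- surjective_pairing; reflexivity. }
  rewrite <- surjective_pairing; exact G1.
- apply continuous_ext with (f := fun y => Im (g (Re (F y), Im (F y)))).
  { intros y; rewrite <- surjective_pairing; reflexivity. }
  apply (continuous_comp_2 (U := T) (V := R_UniformSpace) (W := R_UniformSpace) (X := R_UniformSpace)
    (fun y => Re (F y)) (fun y => Im (F y)) (fun a b => Im (g (a, b)))); try assumption.
  apply continuous_ext with (f := fun y : C => Im (g y)).
  { intros y; simpl; rewrite <- surjective_pairing; reflexivity. }
  rewrite <- surjective_pairing; exact G2.
Qed.

Lemma Ccontinuous_pow F x n : Ccontinuous F x -> Ccontinuous (fun y => F y ^ n)%C x.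
Proof.
intros A; induction n as [|n IH]; simpl; [apply Ccontinuous_const | apply Ccontinuous_mult; assumption].
Qed.

Lemma Cmod_le_abs (z : C) : Cmod z <= Rabs (Re z) + Rabs (Im z).
Proof.
unfold Cmod, Re, Im; apply Rsqr_incr_0_var; [| pose proof (Rabs_pos (fst z)); pose proof (Rabs_pos (snd z)); lra].
rewrite Rsqr_sqrt by nra; unfold Rsqr.
pose proof (Rabs_pos (fst z)); pose proof (Rabs_pos (snd z)).
rewrite <- (pow2_abs (fst z)), <- (pow2_abs (snd z)); nra.
Qed.

Lemma im_le_Cmod (z : C) : Rabs (Im z) <= Cmod z.
Proof.
unfold Cmod, Im; apply Rsqr_incr_0_var; [| apply sqrt_pos].
rewrite Rsqr_sqrt by nra; rewrite <- Rsqr_abs; unfold Rsqr; nra.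
Qed.

Lemma re_minus_le_Cmod (a b : C) : Rabs (Re a - Re b) <= Cmod (a - b).
Proof. unfold Rminus; rewrite <- re_opp, <- re_plus; apply re_le_Cmod. Qed.

Lemma im_minus_le_Cmod (a b : C) : Rabs (Im a - Im b) <= Cmod (a - b).
Proof. unfold Rminus; rewrite <- im_opp, <- im_plus; apply im_le_Cmod. Qed.

Lemma Ccontinuous_eps F x : Ccontinuous F x <-> forall eps, 0 < eps -> locally x (fun y => Cmod (F y - F x) < eps).
Proof.
split.
- intros [A B] eps He.
  assert (He2 : 0 < eps / 2) by lra.
  generalize (filter_and _ _ (proj1 (filterlim_locally _ _) A (mkposreal _ He2)) (proj1 (filterlim_locally _ _) B (mkposreal _ He2))).
  apply filter_imp; intros y [H1 H2].
  eapply Rle_lt_trans; [apply Cmod_le_abs |].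
  change (Rabs (Re (F y) - Re (F x)) < eps / 2) in H1.
  change (Rabs (Im (F y) - Im (F x)) < eps / 2) in H2.
  unfold Cminus; rewrite re_plus, im_plus, re_opp, im_opp; unfold Rminus in *; lra.
- intros H; split; apply filterlim_locally; intros eps; generalize (H eps (cond_pos eps)); apply filter_imp; intros y Hy.
  + eapply Rle_lt_trans; [apply re_minus_le_Cmod | exact Hy].
  + eapply Rle_lt_trans; [apply im_minus_le_Cmod | exact Hy].
Qed.

Lemma Ccontinuous_filterlim F x : Ccontinuous F x -> filterlim F (locally x) (locally (T := C_UniformSpace) (F x)).
Proof.
intros H; apply filterlim_locally; intros eps.
generalize (proj1 (Ccontinuous_eps F x) H eps (cond_pos eps)); apply filter_imp; intros y Hy; split.
- eapply Rle_lt_trans; [apply re_minus_le_Cmod | exact Hy].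
- eapply Rle_lt_trans; [apply im_minus_le_Cmod | exact Hy].
Qed.

Lemma Ccontinuous_nonzero F x : Ccontinuous F x -> F x <> 0 -> locally x (fun y => F y <> 0).
Proof.
intros H N; generalize (proj1 (Ccontinuous_eps F x) H (Cmod (F x)) (proj1 (Cmod_gt_0 _) N)).
apply filter_imp; intros y Hy E; rewrite E in Hy.
replace (0 - F x)%C with (- F x)%C in Hy by ring; rewrite Cmod_opp in Hy; lra.
Qed.

End ComplexContinuity.

Lemma Ccontinuous_id (z : C) : Ccontinuous (T := C_UniformSpace) (fun y => y) z.
Proof. split; [apply (continuous_fst (U := R_UniformSpace) (V := R_UniformSpace)) | apply (continuous_snd (U := R_UniformSpace) (V := R_UniformSpace))]. Qed.

(** Balls of [C_UniformSpace] are squares in the two coordinates; this passes to round disks, in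
    which the later estimates are made. *)
Lemma locally_Cmod (z : C) (P : C -> Prop) :
  locally (T := C_UniformSpace) z P <-> exists d, 0 < d /\ forall y, Cmod (y - z) < d -> P y.
Proof.
split.
- intros [d Hd]; exists d; split; [apply cond_pos |]; intros y Hy; apply Hd; split.
  + eapply Rle_lt_trans; [apply re_minus_le_Cmod | exact Hy].
  + eapply Rle_lt_trans; [apply im_minus_le_Cmod | exact Hy].
- intros [d [H1 H2]].
  generalize (proj1 (Ccontinuous_eps _ z) (Ccontinuous_id z) d H1); apply filter_imp; intros y; apply H2.
Qed.

Lemma locally_disk (r : R) (z : C) : Cmod z < r -> locally (T := C_UniformSpace) z (fun y => Cmod y < r).
Proof.
intros H; apply locally_Cmod; exists (r - Cmod z); split; [lra |]; intros y Hy.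
replace y with (z + (y - z))%C by ring.
eapply Rle_lt_trans; [apply Cmod_triangle |]; lra.
Qed.

(* Caratheodory's form of the complex derivative: products, chain rule and inverse functions become statements about continuity. *)
Definition is_Cderive (f : C -> C) (z l : C) : Prop :=
  exists p : C -> C, locally (T := C_UniformSpace) z (fun y => f y - f z = p y * (y - z))%C /\
    p z = l /\ Ccontinuous (T := C_UniformSpace) p z.

Lemma is_Cderive_Ccontinuous f z l : is_Cderive f z l -> Ccontinuous (T := C_UniformSpace) f z.
Proof.
intros [p [H1 [H2 H3]]].
apply Ccontinuous_ext_loc with (fun y => f z + p y * (y - z))%C.
- apply filter_imp with (2 := H1); intros y E; rewrite <- E; ring.
- apply Ccontinuous_plus; [apply Ccontinuous_const |]; apply Ccontinuous_mult; [exact H3 |].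
  apply Ccontinuous_minus; [apply Ccontinuous_id | apply Ccontinuous_const].
Qed.

Lemma is_Cderive_ext_loc f g z l : locally (T := C_UniformSpace) z (fun y => f y = g y) -> is_Cderive f z l -> is_Cderive g z l.
Proof.
intros H [p [H1 [H2 H3]]]; exists p; split; [| split; assumption].
rewrite <- (locally_singleton _ _ H).
generalize (filter_and _ _ H H1); apply filter_imp; intros y [E1 E2]; rewrite <- E1; exact E2.
Qed.

Lemma is_Cderive_const c z : is_Cderive (fun _ => c) z 0.
Proof.
exists (fun _ => RtoC 0); split; [| split; [reflexivity | apply Ccontinuous_const]].
apply filter_forall; intros y; ring.
Qed.

Lemma is_Cderive_id z : is_Cderive (fun y => y) z 1.
Proof.
exists (fun _ => RtoC 1); split; [| split; [reflexivity | apply Ccontinuous_const]].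
apply filter_forall; intros y; ring.
Qed.

Lemma is_Cderive_plus f g z a b : is_Cderive f z a -> is_Cderive g z b -> is_Cderive (fun y => f y + g y)%C z (a + b).
Proof.
intros [p [P1 [P2 P3]]] [q [Q1 [Q2 Q3]]]; exists (fun y => p y + q y)%C; split; [| split].
- generalize (filter_and _ _ P1 Q1); apply filter_imp; intros y [E F].
  transitivity ((f y - f z) + (g y - g z))%C; [ring | rewrite E, F; ring].
- rewrite P2, Q2; reflexivity.
- apply Ccontinuous_plus; assumption.
Qed.

Lemma is_Cderive_mult f g z a b : is_Cderive f z a -> is_Cderive g z b -> is_Cderive (fun y => f y * g y)%C z (a * g z + f z * b).
Proof.
intros Hf Hg; pose proof (is_Cderive_Ccontinuous _ _ _ Hg) as Cg.
destruct Hf as [p [P1 [P2 P3]]], Hg as [q [Q1 [Q2 Q3]]].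
exists (fun y => p y * g y + f z * q y)%C; split; [| split].
- generalize (filter_and _ _ P1 Q1); apply filter_imp; intros y [E F].
  transitivity ((f y - f z) * g y + f z * (g y - g z))%C; [ring | rewrite E, F; ring].
- rewrite P2, Q2; reflexivity.
- apply Ccontinuous_plus; apply Ccontinuous_mult; try assumption; apply Ccontinuous_const.
Qed.

Lemma is_Cderive_scal c g z b : is_Cderive g z b -> is_Cderive (fun y => c * g y)%C z (c * b).
Proof.
intros H; replace (c * b)%C with (0 * g z + c * b)%C by ring.
apply (is_Cderive_mult (fun _ => c)); [apply is_Cderive_const | exact H].
Qed.

Lemma is_Cderive_comp f g z a b : is_Cderive f z a -> is_Cderive g (f z) b -> is_Cderive (fun y => g (f y)) z (b * a).
Proof.
intros Hf Hg; pose proof (is_Cderive_Ccontinuous _ _ _ Hf) as Cf.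
destruct Hf as [p [P1 [P2 P3]]], Hg as [q [Q1 [Q2 Q3]]].
exists (fun y => q (f y) * p y)%C; split; [| split].
- generalize (filter_and _ _ P1 (Ccontinuous_filterlim _ _ Cf _ Q1)); apply filter_imp; intros y [E F].
  rewrite F, E; ring.
- rewrite P2, Q2; reflexivity.
- apply Ccontinuous_mult; [| exact P3]; apply (Ccontinuous_comp q f); assumption.
Qed.

Lemma is_Cderive_Cinv (w : C) : w <> 0 -> is_Cderive Cinv w (- / (w * w)).
Proof.
intros H; exists (fun y => - / (y * w))%C; split; [| split; [reflexivity |]].
- generalize (Ccontinuous_nonzero _ _ (Ccontinuous_id w) H); apply filter_imp; intros y Hy; field; split; assumption.
- apply Ccontinuous_opp, Ccontinuous_inv; [apply Ccontinuous_mult; [apply Ccontinuous_id | apply Ccontinuous_const] | apply Cmult_neq_0; assumption].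
Qed.

(** If p is the slope function of E at L w, then y - w = p (L y) (L y - L w) near w. As p (L y)
    stays away from 0 by continuity, / p (L y) is a slope function for L. *)
Lemma is_Cderive_inverse (E L : C -> C) (w a : C) :
  locally (T := C_UniformSpace) w (fun y => E (L y) = y) -> Ccontinuous (T := C_UniformSpace) L w -> is_Cderive E (L w) a -> a <> 0 -> is_Cderive L w (/ a).
Proof.
intros H CL [p [P1 [P2 P3]]] Ha.
pose proof (Ccontinuous_comp p L w CL P3) as Cp.
exists (fun y => / p (L y))%C; split; [| split].
- pose proof (Ccontinuous_nonzero _ _ Cp) as Np; simpl in Np; rewrite P2 in Np; specialize (Np Ha).
  generalize (filter_and _ _ Np (filter_and _ _ H (Ccontinuous_filterlim _ _ CL _ P1))); apply filter_imp.
  intros y [N [E1 E2]].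
  rewrite E1, (locally_singleton _ _ H) in E2; rewrite E2; field; exact N.
- rewrite P2; reflexivity.
- apply Ccontinuous_inv; [exact Cp | rewrite P2; exact Ha].
Qed.

Lemma is_Cderive_eps f z l :
  is_Cderive f z l <-> forall eps, 0 < eps ->
    locally (T := C_UniformSpace) z (fun y => Cmod (f y - f z - l * (y - z)) <= eps * Cmod (y - z)).
Proof.
split.
- intros [p [P1 [P2 P3]]] eps He.
  generalize (filter_and _ _ P1 (proj1 (Ccontinuous_eps _ _) P3 eps He)); apply filter_imp; intros y [E F].
  rewrite E, <- P2; replace (p y * (y - z) - p z * (y - z))%C with ((p y - p z) * (y - z))%C by ring.
  rewrite Cmod_mult; apply Rmult_le_compat_r; [apply Cmod_ge_0 | lra].
- intros H.
  assert (NZ : forall y, y <> z -> (y - z)%C <> 0).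
  { intros y N E; apply N; replace y with (y - z + z)%C by ring; rewrite E; ring. }
  exists (fun y => if Ceq_dec y z then l else (f y - f z) / (y - z))%C; split; [| split].
  + apply filter_forall; intros y; destruct (Ceq_dec y z) as [-> | N]; [ring |].
    field; apply NZ, N.
  + destruct (Ceq_dec z z); [reflexivity | contradiction].
  + apply Ccontinuous_eps; intros eps He.
    assert (He2 : 0 < eps / 2) by lra.
    generalize (H _ He2); apply filter_imp; intros y Hd.
    destruct (Ceq_dec z z) as [_ | N0]; [| contradiction].
    destruct (Ceq_dec y z) as [-> | N].
    * replace (l - l)%C with (RtoC 0) by ring; rewrite Cmod_0; exact He.
    * specialize (NZ y N); pose proof (proj1 (Cmod_gt_0 _) NZ) as Gy.
      replace ((f y - f z) / (y - z) - l)%C with ((f y - f z - l * (y - z)) / (y - z))%C by (field; exact NZ).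
      rewrite Cmod_div by exact NZ.
      apply Rmult_lt_reg_r with (Cmod (y - z)); [exact Gy |].
      unfold Rdiv; rewrite Rmult_assoc, Rinv_l, Rmult_1_r by lra.
      eapply Rle_lt_trans; [exact Hd |]; apply Rmult_lt_compat_r; lra.
Qed.

(** Bridge to the [ex_derive] and [C_derive] of the statement. Neighbourhoods there are disks for
    the absolute value on C, hence the passage through [locally_Cmod]. *)
Lemma is_Cderive_is_derive f z l : is_Cderive f z l <-> is_derive (K := C_AbsRing) (V := C_NormedModule) f z l.
Proof.
rewrite is_Cderive_eps; split.
- intros H; split; [apply is_linear_scal_l |].
  intros x Hx.
  apply (is_filter_lim_locally_unique (V := AbsRing_NormedModule C_AbsRing)) in Hx; subst x.
  intros eps.
  specialize (H eps (cond_pos eps)); apply locally_Cmod in H; destruct H as [d [D1 D2]].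
  exists (mkposreal _ D1); intros y Hy; specialize (D2 y Hy); rewrite Cmult_comm in D2; exact D2.
- intros [_ H] eps He; specialize (H z (fun P HP => HP)).
  destruct (H (mkposreal _ He)) as [d Hd]; apply locally_Cmod; exists d; split; [apply cond_pos |].
  intros y Hy; rewrite Cmult_comm; exact (Hd y Hy).
Qed.

Lemma is_Cderive_unique f z a b : is_Cderive f z a -> is_Cderive f z b -> a = b.
Proof.
intros A B; apply is_Cderive_is_derive in A, B.
rewrite <- (is_C_derive_unique _ _ _ A); apply is_C_derive_unique; exact B.
Qed.

(** * Complex power series *)

Definition Csum (u : nat -> C) : nat -> C := sum_n (G := C_AbelianMonoid) u.

Lemma Csum_S u n : Csum u (S n) = (Csum u n + u (S n))%C.
Proof. exact (sum_Sn (G := C_AbelianMonoid) u n). Qed.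

Lemma Csum_O u : Csum u 0 = u 0%nat.
Proof. exact (sum_O (G := C_AbelianMonoid) u). Qed.

Lemma Csum_ext u v n : (forall k, u k = v k) -> Csum u n = Csum v n.
Proof. exact (sum_n_ext (G := C_AbelianMonoid) u v n). Qed.

Definition is_Cseries (u : nat -> C) (l : C) : Prop :=
  forall eps, 0 < eps -> exists N, forall n, (N <= n)%nat -> Cmod (Csum u n - l) < eps.

Lemma is_Cseries_is_series u l : is_Cseries u l <-> is_series (K := C_AbsRing) (V := C_NormedModule) u l.
Proof.
split.
- intros H; apply filterlim_locally_ball_norm; intros eps.
  destruct (H eps (cond_pos eps)) as [N HN]; exists N; intros n Hn; exact (HN n Hn).
- intros H eps He; pose proof (proj1 (filterlim_locally_ball_norm _ _) H (mkposreal _ He)) as [N HN].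
  exists N; intros n Hn; exact (HN n Hn).
Qed.

Lemma pow_n_Cpow (z : C) n : pow_n (K := C_Ring) z n = (z ^ n)%C.
Proof. induction n as [|n IH]; [reflexivity |]; simpl; rewrite IH; reflexivity. Qed.

Lemma is_pseries_is_Cseries (a : nat -> C) (z l : C) :
  is_pseries (K := C_AbsRing) (V := C_NormedModule) a z l <-> is_Cseries (fun k => a k * z ^ k)%C l.
Proof.
assert (E : forall k, scal (K := C_AbsRing) (V := C_NormedModule) (pow_n (K := C_AbsRing) z k) (a k) = (a k * z ^ k)%C).
{ intros k; rewrite <- pow_n_Cpow; apply Cmult_comm. }
rewrite is_Cseries_is_series; split; apply is_series_ext; intros k; [| symmetry]; apply E.
Qed.

Lemma is_Cseries_ext u v l : (forall k, u k = v k) -> is_Cseries u l -> is_Cseries v l.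
Proof. intros E H eps He; destruct (H eps He) as [N HN]; exists N; intros n Hn; rewrite <- (Csum_ext u v); auto. Qed.

Lemma is_Cseries_plus u v a b : is_Cseries u a -> is_Cseries v b -> is_Cseries (fun k => u k + v k)%C (a + b).
Proof. rewrite !is_Cseries_is_series; intros A B; exact (is_series_plus _ _ _ _ A B). Qed.

Lemma is_Cseries_scal c u a : is_Cseries u a -> is_Cseries (fun k => c * u k)%C (c * a).
Proof. rewrite !is_Cseries_is_series; intros A; exact (is_series_scal c _ _ A). Qed.

Lemma is_Cseries_unique u a b : is_Cseries u a -> is_Cseries u b -> a = b.
Proof.
rewrite !is_Cseries_is_series; intros A B.
exact (filterlim_locally_unique (K := C_AbsRing) (V := C_NormedModule) _ _ _ A B).
Qed.

Lemma is_Cseries_shift u l : is_Cseries (fun k => u (S k)) (l - u 0%nat) <-> is_Cseries u l.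
Proof.
assert (E : forall n, Csum u (S n) = (u 0%nat + Csum (fun k => u (S k)) n)%C).
{ induction n as [|n IH]; [rewrite Csum_S, !Csum_O; reflexivity |].
  rewrite Csum_S, IH, Csum_S; ring. }
split; intros H eps He; destruct (H eps He) as [N HN].
- exists (S N); intros [|n] Hn; [lia |].
  rewrite E; replace (u 0%nat + Csum (fun k => u (S k)) n - l)%C
    with (Csum (fun k => u (S k)) n - (l - u 0%nat))%C by ring; apply HN; lia.
- exists N; intros n Hn; replace (Csum (fun k => u (S k)) n - (l - u 0%nat))%C with (Csum u (S n) - l)%C by (rewrite E; ring).
  apply HN; lia.
Qed.

Lemma is_Cseries_bound u l B : is_Cseries u l -> (forall n, Cmod (Csum u n) <= B) -> Cmod l <= B.
Proof.
intros H HB; apply le_epsilon; intros eps He; destruct (H eps He) as [N HN]; specialize (HN N (Nat.le_refl N)); specialize (HB N).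
replace l with (Csum u N + - (Csum u N - l))%C by ring.
eapply Rle_trans; [apply Cmod_triangle |]; rewrite Cmod_opp; lra.
Qed.

Lemma is_Cseries_terms_bounded u l : is_Cseries u l -> exists M, 0 < M /\ forall n, Cmod (u n) <= M.
Proof.
intros H; destruct (H 1 Rlt_0_1) as [N HN].
assert (P : forall n, exists M, 0 < M /\ forall k, (k <= n)%nat -> Cmod (u k) <= M).
{ induction n as [|n [M [H0 HM]]].
  - exists (Cmod (u 0%nat) + 1); pose proof (Cmod_ge_0 (u 0%nat)); split; [lra |].
    intros k Hk; replace k with 0%nat by lia; lra.
  - exists (M + Cmod (u (S n))); pose proof (Cmod_ge_0 (u (S n))); split; [lra |].
    intros k Hk; destruct (Nat.eq_dec k (S n)) as [-> | Hne]; [lra |].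
    specialize (HM k ltac:(lia)); lra. }
(* Beyond N a term is the difference of two partial sums, each within 1 of l: this is the 2. *)
destruct (P N) as [M [H0 HM]]; exists (M + 2); split; [lra |]; intros n.
destruct (Nat.le_gt_cases n N) as [Hn | Hn]; [specialize (HM n Hn); lra |].
destruct n as [|n]; [lia |].
replace (u (S n)) with ((Csum u (S n) - l) + - (Csum u n - l))%C by (rewrite Csum_S; ring).
eapply Rle_trans; [apply Cmod_triangle |]; rewrite Cmod_opp.
pose proof (HN n ltac:(lia)); pose proof (HN (S n) ltac:(lia)); lra.
Qed.

Lemma Csum_le_Series (u : nat -> C) (b : nat -> R) n :
  (forall k, Cmod (u k) <= b k) -> ex_series b -> Cmod (Csum u n) <= Series b.
Proof.
intros Hb Hs.
assert (Pos : forall k, 0 <= b k) by (intros k; eapply Rle_trans; [apply Cmod_ge_0 | apply Hb]).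
apply Rle_trans with (sum_n b n).
- induction n as [|n IH]; [rewrite Csum_O, sum_O; apply Hb |].
  rewrite Csum_S, sum_Sn; eapply Rle_trans; [apply Cmod_triangle |]; specialize (Hb (S n)); unfold plus; simpl; lra.
- apply (is_lim_seq_incr_compare (sum_n b) (Series b)).
  + apply Series_correct, Hs.
  + intros k; rewrite sum_Sn; specialize (Pos (S k)); unfold plus; simpl; lra.
Qed.

Lemma is_Cseries_majorant (u : nat -> C) (b : nat -> R) :
  (forall k, Cmod (u k) <= b k) -> ex_series b -> exists l, is_Cseries u l.
Proof.
intros Hb Hs.
destruct (ex_series_le (K := C_AbsRing) (V := C_CompleteNormedModule) u b Hb Hs) as [l Hl].
exists l; apply is_Cseries_is_series, Hl.
Qed.

(** The squared index is the price of the second-order remainder of z^n in [Cpow_taylor2]. *)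
Lemma ex_series_square_geom (x : R) : 0 < x < 1 -> ex_series (fun n => INR (S n) ^ 2 * x ^ n).
Proof.
intros Hx; apply ex_series_Rabs, ex_series_DAlembert with x; [lra | |].
- intros n; apply Rgt_not_eq, Rmult_lt_0_compat; apply pow_lt; [apply lt_0_INR; lia | lra].
- apply is_lim_seq_ext with (fun n => (1 + / INR (S n)) ^ 2 * x).
  + intros n; rewrite (S_INR (S n)).
    assert (0 < INR (S n)) by (apply lt_0_INR; lia).
    assert (0 < x ^ n) by (apply pow_lt; lra).
    change (x ^ S n) with (x * x ^ n); set (N := INR (S n)) in *; set (p := x ^ n) in *.
    rewrite Rabs_right; [field; lra |].
    apply Rle_ge, Rlt_le, Rdiv_lt_0_compat; apply Rmult_lt_0_compat; try apply pow_lt; nra.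
  + replace (Finite x) with (Finite ((1 + 0) ^ 2 * x)) by (f_equal; ring).
    assert (L : is_lim_seq (fun n => 1 + / INR (S n)) (1 + 0)).
    { apply is_lim_seq_plus'; [apply is_lim_seq_const |].
      apply is_lim_seq_incr_1 with (u := fun n => / INR n).
      replace (Finite 0) with (Rbar_inv p_infty) by reflexivity; apply is_lim_seq_inv; [apply is_lim_seq_INR | discriminate]. }
    apply is_lim_seq_mult'; [| apply is_lim_seq_const].
    apply is_lim_seq_mult'; [exact L |]; apply is_lim_seq_mult'; [exact L | apply is_lim_seq_const].
Qed.

(** The usual bound n R^(n-1) |h|, multiplied by R so that no exponent n - 1 occurs and n = 0 is not
    special. *)
Lemma Cpow_taylor1 (R : R) (z h : C) n : Cmod z <= R -> Cmod (z + h) <= R ->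
  R * Cmod ((z + h) ^ n - z ^ n) <= INR n * R ^ n * Cmod h.
Proof.
intros Hz Hh; pose proof (Cmod_ge_0 z); pose proof (Cmod_ge_0 h).
induction n as [|n IH].
- simpl; replace (1 - 1)%C with (RtoC 0) by ring; rewrite Cmod_0; lra.
- replace ((z + h) ^ S n - z ^ S n)%C with (z * ((z + h) ^ n - z ^ n) + h * (z + h) ^ n)%C by (simpl; ring).
  rewrite S_INR; simpl pow.
  apply Rle_trans with (R * (Cmod z * Cmod ((z + h) ^ n - z ^ n) + Cmod h * Cmod (z + h) ^ n)).
  { apply Rmult_le_compat_l; [lra |]; rewrite <- Cmod_pow, <- !Cmod_mult; apply Cmod_triangle. }
  assert (P : Cmod (z + h) ^ n <= R ^ n) by (apply pow_incr; split; [apply Cmod_ge_0 | exact Hh]).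
  assert (Q : Cmod h * Cmod (z + h) ^ n <= Cmod h * R ^ n) by (apply Rmult_le_compat_l; assumption).
  assert (S : Cmod z * (R * Cmod ((z + h) ^ n - z ^ n)) <= R * (INR n * R ^ n * Cmod h)).
  { apply Rmult_le_compat; try assumption; apply Rmult_le_pos; [lra | apply Cmod_ge_0]. }
  apply (Rmult_le_compat_l R) in Q; [| lra]; lra.
Qed.

(** The remainder for n + 1 is z times the remainder for n plus h times a first-order difference;
    the constants close up because N^2 + N <= (N + 1)^2. As before, R^2 on the left avoids a
    subtraction in the exponent. *)
Lemma Cpow_taylor2 (R : R) (z h : C) n : Cmod z <= R -> Cmod (z + h) <= R ->
  R ^ 2 * Cmod ((z + h) ^ S n - z ^ S n - h * (INR (S n) * z ^ n)) <= INR (S n) ^ 2 * R ^ S n * Cmod h ^ 2.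
Proof.
intros Hz Hh; pose proof (Cmod_ge_0 z) as Z0; pose proof (Cmod_ge_0 h) as H0.
assert (RP : forall k, 0 <= R ^ k) by (intros; apply pow_le; lra).
induction n as [|n IH].
- replace ((z + h) ^ 1 - z ^ 1 - h * (INR 1 * z ^ 0))%C with (RtoC 0) by (simpl; ring).
  rewrite Cmod_0, Rmult_0_r; apply Rmult_le_pos; [apply Rmult_le_pos; [apply pow2_ge_0 | apply RP] | apply pow2_ge_0].
- replace ((z + h) ^ S (S n) - z ^ S (S n) - h * (INR (S (S n)) * z ^ S n))%C
    with (z * ((z + h) ^ S n - z ^ S n - h * (INR (S n) * z ^ n)) + h * ((z + h) ^ S n - z ^ S n))%C
    by (rewrite (S_INR (S n)), RtoC_plus; simpl; ring).
  pose proof (Cpow_taylor1 R z h (S n) Hz Hh) as T1.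
  set (e := ((z + h) ^ S n - z ^ S n - h * (INR (S n) * z ^ n))%C) in *.
  set (d := ((z + h) ^ S n - z ^ S n)%C) in *.
  apply Rle_trans with (R ^ 2 * (Cmod z * Cmod e + Cmod h * Cmod d)).
  { apply Rmult_le_compat_l; [apply pow2_ge_0 |]; rewrite <- !Cmod_mult; apply Cmod_triangle. }
  assert (S1 : Cmod z * (R ^ 2 * Cmod e) <= R * (INR (S n) ^ 2 * R ^ S n * Cmod h ^ 2)).
  { apply Rmult_le_compat; try assumption; apply Rmult_le_pos; [apply pow2_ge_0 | apply Cmod_ge_0]. }
  assert (S2 : (R * Cmod h) * (R * Cmod d) <= (R * Cmod h) * (INR (S n) * R ^ S n * Cmod h)).
  { apply Rmult_le_compat_l; [apply Rmult_le_pos; lra | exact T1]. }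
  rewrite (S_INR (S n)); set (N := INR (S n)) in *.
  assert (0 < N) by (apply lt_0_INR; lia).
  replace (R ^ S (S n)) with (R * R ^ S n) by reflexivity.
  set (r := R ^ S n) in *; assert (0 <= r) by apply RP.
  assert (0 <= R * r * Cmod h ^ 2) by (apply Rmult_le_pos; [apply Rmult_le_pos; lra | apply pow2_ge_0]).
  nra.
Qed.

Lemma is_Cderive_quadratic (f : C -> C) (z l : C) (d K : R) : 0 < d -> 0 <= K ->
  (forall h, Cmod h < d -> Cmod (f (z + h) - f z - h * l) <= K * Cmod h ^ 2)%C -> is_Cderive f z l.
Proof.
intros Hd HK H; apply is_Cderive_eps; intros eps He; apply locally_Cmod.
exists (Rmin d (eps / (K + 1))); split.
{ apply Rmin_glb_lt; [exact Hd | apply Rdiv_lt_0_compat; lra]. }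
intros y Hy; specialize (H (y - z)%C (Rlt_le_trans _ _ _ Hy (Rmin_l _ _))).
replace (z + (y - z))%C with y in H by ring; rewrite Cmult_comm.
eapply Rle_trans; [exact H |].
pose proof (Rlt_le_trans _ _ _ Hy (Rmin_r _ _)) as H2; pose proof (Cmod_ge_0 (y - z)) as H3.
simpl; rewrite Rmult_1_r, <- Rmult_assoc; apply Rmult_le_compat_r; [exact H3 |].
apply Rmult_lt_compat_l with (r := K + 1) in H2; [| lra].
replace ((K + 1) * (eps / (K + 1))) with eps in H2 by (field; lra); lra.
Qed.

(** The error f(z + h) - f(z) - h l is itself the sum of a series, whose terms [Cpow_taylor2] bounds
    by |h|^2 times a convergent majorant; [is_Cderive_quadratic] concludes. Giving the derived
    series along with the derivative makes the result iterable. *)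
Theorem pseries_derive (a : nat -> C) (f : C -> C) (rho : R) :
  (forall z, Cmod z < rho -> is_Cseries (fun k => a k * z ^ k)%C (f z)) ->
  forall z, Cmod z < rho ->
  exists l, is_Cseries (fun k => (INR (S k) * a (S k)) * z ^ k)%C l /\ is_Cderive f z l.
Proof.
intros H z Hz; pose proof (Cmod_ge_0 z) as Z0.
(* R0 and R1 cut the interval from |z| to rho into thirds: the terms are bounded at R1, z + h stays
   within R0, and R0 / R1 < 1 is the ratio of the majorant. *)
set (R1 := (Cmod z + 2 * rho) / 3); set (R0 := (2 * Cmod z + rho) / 3).
assert (HR : Cmod z < R0 < R1 /\ R1 < rho /\ 0 < R0) by (unfold R0, R1; lra).
destruct (is_Cseries_terms_bounded _ _ (H (RtoC R1) ltac:(rewrite Cmod_R, Rabs_right; lra))) as [M [M0 HM]].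
assert (Ha : forall n, Cmod (a n) * R0 ^ n <= M * (R0 / R1) ^ n).
{ intros n; specialize (HM n); rewrite Cmod_mult, Cmod_pow, Cmod_R, Rabs_right in HM by lra.
  assert (0 < R1 ^ n) by (apply pow_lt; lra).
  unfold Rdiv; rewrite Rpow_mult_distr, pow_inv.
  apply Rmult_le_reg_r with (R1 ^ n); [assumption |].
  replace (M * (R0 ^ n * / R1 ^ n) * R1 ^ n) with (M * R0 ^ n) by (field; lra).
  pose proof (pow_lt R0 n ltac:(lra)); nra. }
set (x := R0 / R1) in *.
assert (Hx : 0 < x < 1).
{ unfold x; split; [apply Rdiv_lt_0_compat; lra |]; apply Rmult_lt_reg_r with R1; [lra |].
  unfold Rdiv; rewrite Rmult_assoc, Rinv_l; lra. }
set (g := fun n => INR (S n) ^ 2 * x ^ n).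
assert (Eg : ex_series g) by (apply ex_series_square_geom, Hx).
assert (Ha' : forall n, Cmod (a (S n)) * R0 ^ S n <= M * x ^ n).
{ intros n; eapply Rle_trans; [apply Ha |]; simpl; apply Rmult_le_compat_l; [lra |].
  pose proof (pow_lt x n ltac:(lra)); nra. }
assert (IN : forall n, 1 <= INR (S n)) by (intros n; rewrite S_INR; pose proof (pos_INR n); lra).
destruct (is_Cseries_majorant (fun k => (INR (S k) * a (S k)) * z ^ k)%C (fun k => M / R0 * g k)) as [l Hl].
{ intros k; rewrite !Cmod_mult, Cmod_pow, Cmod_R, Rabs_right by (specialize (IN k); lra).
  assert (P : Cmod z ^ k <= R0 ^ k) by (apply pow_incr; lra).
  apply Rle_trans with (INR (S k) * (Cmod (a (S k)) * R0 ^ k)).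
  { rewrite Rmult_assoc; apply Rmult_le_compat_l; [specialize (IN k); lra |].
    apply Rmult_le_compat_l; [apply Cmod_ge_0 | exact P]. }
  apply Rle_trans with (INR (S k) * (M / R0 * x ^ k)).
  { apply Rmult_le_compat_l; [specialize (IN k); lra |].
    apply Rmult_le_reg_l with R0; [lra |].
    replace (R0 * (M / R0 * x ^ k)) with (M * x ^ k) by (field; lra).
    eapply Rle_trans; [| apply (Ha' k)]; simpl; lra. }
  unfold g; replace (M / R0 * (INR (S k) ^ 2 * x ^ k)) with (INR (S k) * (INR (S k) * (M / R0 * x ^ k))) by ring.
  apply Rmult_le_compat_l; [specialize (IN k); lra |].
  assert (0 <= M / R0 * x ^ k) by (apply Rmult_le_pos; [apply Rlt_le, Rdiv_lt_0_compat | apply pow_le]; lra).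
  specialize (IN k); nra. }
{ exact (ex_series_scal_l (V := R_NormedModule) (M / R0) g Eg). }
exists l; split; [exact Hl |].
apply is_Cderive_quadratic with (R0 - Cmod z) (Series (fun k => M / R0 ^ 2 * g k)); [lra | |].
(* The sum of the majorant is nonnegative because it dominates the modulus of a partial sum of the
   zero series. *)
{ eapply Rle_trans; [apply (Cmod_ge_0 (Csum (fun _ => RtoC 0) 0)) | apply Csum_le_Series].
  - intros n; rewrite Cmod_0.
    apply Rmult_le_pos; [apply Rlt_le, Rdiv_lt_0_compat; [lra | apply pow_lt; lra] |].
    apply Rmult_le_pos; [apply pow2_ge_0 | apply pow_le; lra].
  - exact (ex_series_scal_l (V := R_NormedModule) (M / R0 ^ 2) g Eg). }
intros h Hh; pose proof (Cmod_ge_0 h).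
assert (Hzh : Cmod (z + h) <= R0) by (eapply Rle_trans; [apply Cmod_triangle |]; lra).
apply (is_Cseries_bound (fun k => a (S k) * ((z + h) ^ S k - z ^ S k - h * (INR (S k) * z ^ k)))%C).
- replace (f (z + h) - f z - h * l)%C with ((f (z + h) - a 0%nat * (z + h) ^ 0) + (-(1)) * (f z - a 0%nat * z ^ 0) + - h * l)%C by (simpl; ring).
  apply is_Cseries_ext with (fun k => a (S k) * (z + h) ^ S k + (-(1)) * (a (S k) * z ^ S k) + - h * (INR (S k) * a (S k) * z ^ k))%C.
  { intros k; ring. }
  apply is_Cseries_plus; [apply is_Cseries_plus |].
  + apply (is_Cseries_shift (fun k => a k * (z + h) ^ k)%C), H; lra.
  + apply is_Cseries_scal, (is_Cseries_shift (fun k => a k * z ^ k)%C), H; lra.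
  + apply is_Cseries_scal, Hl.
- intros n.
  rewrite Rmult_comm, <- Series_scal_l; apply Csum_le_Series.
  + intros k; rewrite Cmod_mult.
    pose proof (Cpow_taylor2 R0 z h k ltac:(lra) Hzh) as T.
    set (e := ((z + h) ^ S k - z ^ S k - h * (INR (S k) * z ^ k))%C) in *.
    apply Rmult_le_reg_l with (R0 ^ 2); [apply pow_lt; lra |].
    replace (R0 ^ 2 * (Cmod h ^ 2 * (M / R0 ^ 2 * g k))) with (Cmod h ^ 2 * INR (S k) ^ 2 * (M * x ^ k)) by (unfold g; field; lra).
    apply Rle_trans with (Cmod (a (S k)) * (INR (S k) ^ 2 * R0 ^ S k * Cmod h ^ 2)).
    * replace (R0 ^ 2 * (Cmod (a (S k)) * Cmod e)) with (Cmod (a (S k)) * (R0 ^ 2 * Cmod e)) by ring.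
      apply Rmult_le_compat_l; [apply Cmod_ge_0 | exact T].
    * replace (Cmod (a (S k)) * (INR (S k) ^ 2 * R0 ^ S k * Cmod h ^ 2))
        with (Cmod h ^ 2 * INR (S k) ^ 2 * (Cmod (a (S k)) * R0 ^ S k)) by ring.
      apply Rmult_le_compat_l; [apply Rmult_le_pos; apply pow2_ge_0 | apply Ha'].
  + exact (ex_series_scal_l (V := R_NormedModule) (Cmod h ^ 2) _ (ex_series_scal_l (V := R_NormedModule) (M / R0 ^ 2) g Eg)).
Qed.

(** * Curves and the homotopy form of the Cauchy formula *)

Lemma is_derive_caratheodory (f p : R -> R) (t : R) :
  locally t (fun s => f s - f t = p s * (s - t)) -> continuous p t -> is_derive f t (p t).
Proof.
intros H Hp; apply is_derive_Reals; intros eps He.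
destruct (filter_and _ _ H (proj1 (filterlim_locally _ _) Hp (mkposreal _ He))) as [d Hd].
exists d; intros h Hh1 Hh2.
destruct (Hd (t + h)) as [E1 E2].
{ change (Rabs (t + h - t) < d); replace (t + h - t) with h by ring; exact Hh2. }
replace (f (t + h) - f t) with (p (t + h) * h) by (rewrite E1; ring).
replace (p (t + h) * h / h) with (p (t + h)) by (field; exact Hh1); exact E2.
Qed.

Lemma caratheodory_is_derive (f : R -> R) (t a : R) : is_derive f t a ->
  exists p : R -> R, (forall s, f s - f t = p s * (s - t)) /\ p t = a /\ continuous p t.
Proof.
intros H; apply is_derive_Reals in H.
exists (fun s => if Req_dec_T s t then a else (f s - f t) / (s - t)); split; [| split].
- intros s; destruct (Req_dec_T s t) as [-> | N]; [ring | field; lra].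
- destruct (Req_dec_T t t); [reflexivity | contradiction].
- apply filterlim_locally; intros eps; destruct (H eps (cond_pos eps)) as [d Hd].
  exists d; intros s Hs; change R in (type of s); change (Rabs (s - t) < d) in Hs.
  destruct (Req_dec_T t t) as [_ | N0]; [| contradiction].
  destruct (Req_dec_T s t) as [-> | N]; [apply ball_center |].
  specialize (Hd (s - t) ltac:(lra) Hs); replace (t + (s - t)) with s in Hd by ring; exact Hd.
Qed.

(** The slope-function form again, now with a real parameter, so that the chain rule with
    [is_Cderive] is a product of slopes. *)
Definition is_curve_derive (c : R -> C) (t : R) (l : C) : Prop :=
  exists p : R -> C, locally t (fun s => c s - c t = p s * (s - t))%C /\ p t = l /\ Ccontinuous (T := R_UniformSpace) p t.

Lemma is_curve_derive_Re c t l : is_curve_derive c t l -> is_derive (fun s => Re (c s)) t (Re l).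
Proof.
intros [p [P1 [P2 P3]]]; rewrite <- P2.
apply (is_derive_caratheodory _ (fun s => Re (p s))); [| apply P3].
apply filter_imp with (2 := P1); intros s E.
rewrite <- re_scal_r, RtoC_minus, <- E; unfold Cminus; rewrite re_plus, re_opp; reflexivity.
Qed.

Lemma is_curve_derive_Im c t l : is_curve_derive c t l -> is_derive (fun s => Im (c s)) t (Im l).
Proof.
intros [p [P1 [P2 P3]]]; rewrite <- P2.
apply (is_derive_caratheodory _ (fun s => Im (p s))); [| apply P3].
apply filter_imp with (2 := P1); intros s E.
rewrite <- im_scal_r, RtoC_minus, <- E; unfold Cminus; rewrite im_plus, im_opp; reflexivity.
Qed.

Lemma is_curve_derive_pair (x y : R -> R) t a b : is_derive x t a -> is_derive y t b -> is_curve_derive (fun s => (x s, y s)) t (a, b).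
Proof.
intros H1 H2; destruct (caratheodory_is_derive _ _ _ H1) as [p [P1 [P2 P3]]].
destruct (caratheodory_is_derive _ _ _ H2) as [q [Q1 [Q2 Q3]]].
exists (fun s => (p s, q s)); split; [| split; [rewrite P2, Q2; reflexivity | split; assumption]].
apply filter_forall; intros s; rewrite <- RtoC_minus.
apply injective_projections; simpl.
- transitivity (x s - x t); [reflexivity |]; rewrite P1; ring.
- transitivity (y s - y t); [reflexivity |]; rewrite Q1; ring.
Qed.

Lemma is_curve_derive_Ccontinuous c t l : is_curve_derive c t l -> Ccontinuous (T := R_UniformSpace) c t.
Proof.
intros [p [P1 [P2 P3]]].
apply Ccontinuous_ext_loc with (fun s => c t + p s * (s - t))%C.
- apply filter_imp with (2 := P1); intros s E; rewrite <- E; ring.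
- apply Ccontinuous_plus; [apply Ccontinuous_const |]; apply Ccontinuous_mult; [exact P3 |].
  apply Ccontinuous_minus; [| apply Ccontinuous_const]; split; [apply continuous_id | apply continuous_const].
Qed.

Lemma is_curve_derive_comp (f : C -> C) c t a l : is_curve_derive c t a -> is_Cderive f (c t) l -> is_curve_derive (fun s => f (c s)) t (l * a).
Proof.
intros Hc [q [Q1 [Q2 Q3]]].
pose proof (is_curve_derive_Ccontinuous _ _ _ Hc) as Cc0.
destruct Hc as [p [P1 [P2 P3]]].
exists (fun s => q (c s) * p s)%C; split; [| split].
- generalize (filter_and _ _ P1 (Ccontinuous_filterlim _ _ Cc0 _ Q1)); apply filter_imp; intros s [E F].
  rewrite F, E; ring.
- rewrite P2, Q2; reflexivity.
- apply Ccontinuous_mult; [| exact P3]; apply (Ccontinuous_comp q c); assumption.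
Qed.

Lemma is_curve_derive_line (z d : C) t : is_curve_derive (fun s => z + s * d)%C t d.
Proof.
exists (fun _ => d); split; [| split; [reflexivity | apply Ccontinuous_const]].
apply filter_forall; intros s; ring.
Qed.

(* On the unit disk, with a continuous derivative: this makes Goursat's argument unnecessary. *)
Definition holomorphic (f : C -> C) : Prop :=
  exists f' : C -> C, forall z, in_disk z -> is_Cderive f z (f' z) /\ Ccontinuous (T := C_UniformSpace) f' z.

Definition cis (x : R) : C := (cos x, sin x).

Lemma is_curve_derive_cis x : is_curve_derive cis x (Ci * cis x).
Proof.
replace (Ci * cis x)%C with ((- sin x, cos x) : C) by (apply injective_projections; simpl; ring).
apply (is_curve_derive_pair cos sin); apply is_derive_Reals; [apply derivable_pt_lim_cos | apply derivable_pt_lim_sin].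
Qed.

Lemma Cmod_cis x : Cmod (cis x) = 1.
Proof.
unfold Cmod, cis; simpl; rewrite !Rmult_1_r; pose proof (sin2_cos2 x) as H; unfold Rsqr in H.
replace (cos x * cos x + sin x * sin x) with 1 by lra; apply sqrt_1.
Qed.

Lemma is_curve_derive_scal (k : C) c t a : is_curve_derive c t a -> is_curve_derive (fun s => k * c s)%C t (k * a).
Proof.
intros H; apply (is_curve_derive_comp (fun y => k * y)%C c); [exact H |].
pose proof (is_Cderive_scal k _ (c t) _ (is_Cderive_id (c t))) as E; rewrite Cmult_1_r in E; exact E.
Qed.

Lemma Cmod_circle rho x : 0 <= rho -> Cmod (rho * cis x) = rho.
Proof. intros H; rewrite Cmod_mult, Cmod_cis, Cmod_R, Rabs_right; lra. Qed.

Lemma is_curve_derive_circle (rho : R) x : is_curve_derive (fun x => rho * cis x)%C x (Ci * (rho * cis x)).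
Proof.
replace (Ci * (rho * cis x))%C with (rho * (Ci * cis x))%C by ring.
apply (is_curve_derive_scal rho cis), is_curve_derive_cis.
Qed.

Section Circle.
Context (g g' : C -> C) (z : C) (rho : R).
Context (Hg : forall y, in_disk y -> is_Cderive g y (g' y) /\ Ccontinuous (T := C_UniformSpace) g' y).
Context (Hrho : Cmod z < rho < 1).

Let c (x : R) : C := (rho * cis x)%C.
Let P (t x : R) : C := (z + t * (c x - z))%C.

Lemma circle_modulus x : Cmod (c x) = rho.
Proof. pose proof (Cmod_ge_0 z); apply Cmod_circle; lra. Qed.

Lemma circle_neq x : (c x - z)%C <> 0.
Proof.
intros E; pose proof (circle_modulus x) as H; replace (c x) with z in H by (replace z with (c x - (c x - z))%C by ring; rewrite E; ring); lra.
Qed.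

(** Margin by which t may leave [0, 1], so that one can differentiate at both endpoints: the points
    z + t (c - z) then have modulus at most rho (1 + 2 d) < 1. *)
Let d : R := (1 - rho) / 4.

Lemma homotopy_in_disk t x : - d < t < 1 + d -> in_disk (P t x).
Proof.
intros Ht; unfold in_disk, P; replace (z + t * (c x - z))%C with ((1 - t)%R * z + t * c x)%C by (rewrite RtoC_minus; ring).
eapply Rle_lt_trans; [apply Cmod_triangle |].
rewrite !Cmod_mult, !Cmod_R, circle_modulus; pose proof (Cmod_ge_0 z); unfold d in Ht.
unfold Rabs; repeat destruct Rcase_abs; nra.
Qed.

(** The factor c - z from the chain rule cancels the denominator of the Cauchy kernel. *)
Lemma homotopy_derive_t t x : - d < t < 1 + d ->
  is_derive (fun s => Re (g (P s x) * (c x / (c x - z)))%C) t (Re (g' (P t x) * c x)%C).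
Proof.
intros Ht.
replace (g' (P t x) * c x)%C with (c x / (c x - z) * (g' (P t x) * (c x - z)))%C by (field; apply circle_neq).
apply is_derive_ext with (fun s => Re (c x / (c x - z) * g (P s x))%C).
{ intros s; f_equal; ring. }
apply (is_curve_derive_Re (fun s => c x / (c x - z) * g (P s x))%C), (is_curve_derive_scal _ (fun s => g (P s x))).
apply (is_curve_derive_comp g (fun s => P s x)); [apply is_curve_derive_line | apply Hg, homotopy_in_disk, Ht].
Qed.

(** Since c' = i c, the point z + t (c - z) moves in x with velocity t i c. Multiplication by -i
    turns this into t times the integrand of [homotopy_derive_t], which is thus exact in x and
    integrates to 0 over a period. *)
Lemma homotopy_derive_x t x : - d < t < 1 + d ->
  is_derive (fun y => Re (- Ci * g (P t y))%C) x (t * Re (g' (P t x) * c x)%C).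
Proof.
intros Ht; rewrite <- re_scal_l.
replace (t * (g' (P t x) * c x))%C with (- Ci * (g' (P t x) * (t * (Ci * c x))))%C.
2: { transitivity (- (Ci * Ci) * (t * (g' (P t x) * c x)))%C; [ring |].
     replace (Ci * Ci)%C with (- (1))%C by (apply injective_projections; simpl; ring); ring. }
apply (is_curve_derive_Re (fun y => - Ci * g (P t y))%C), (is_curve_derive_scal _ (fun y => g (P t y))).
apply (is_curve_derive_comp g (fun y => P t y)); [| apply Hg, homotopy_in_disk, Ht].
apply (is_curve_derive_comp (fun w => z + t * (w - z))%C c); [apply is_curve_derive_circle |].
enough (E : is_Cderive (fun w => z + t * (w - z))%C (c x) (0 + t * (1 + 0))).
{ replace (0 + t * (1 + 0))%C with (RtoC t) in E by ring; exact E. }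
apply is_Cderive_plus; [apply is_Cderive_const | apply is_Cderive_scal].
apply (is_Cderive_plus (fun w => w) (fun _ => - z)%C); [apply is_Cderive_id | apply is_Cderive_const].
Qed.

Lemma homotopy_continuous (k : C -> C) t x : (forall y, in_disk y -> Ccontinuous (T := C_UniformSpace) k y) ->
  - d < t < 1 + d -> Ccontinuous (T := prod_UniformSpace R_UniformSpace R_UniformSpace) (fun p => k (P (fst p) (snd p)) * c (snd p))%C (t, x).
Proof.
intros Hk Ht.
assert (C1 : Ccontinuous (T := prod_UniformSpace R_UniformSpace R_UniformSpace) (fun p => c (snd p)) (t, x)).
{ apply Ccontinuous_mult; [apply Ccontinuous_const |]; split.
  - apply (continuous_comp (fun p : R * R => snd p) cos); [apply continuous_snd | apply continuous_cos].
  - apply (continuous_comp (fun p : R * R => snd p) sin); [apply continuous_snd | apply continuous_sin]. }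
apply Ccontinuous_mult; [| exact C1].
apply (Ccontinuous_comp k (fun p : R * R => P (fst p) (snd p))); [| apply Hk, homotopy_in_disk, Ht].
apply Ccontinuous_plus; [apply Ccontinuous_const |]; apply Ccontinuous_mult; [| apply Ccontinuous_minus; [exact C1 | apply Ccontinuous_const]].
split; [apply continuous_fst | apply continuous_const].
Qed.

Lemma homotopy_continuous_x (k : C -> C) t x : (forall y, in_disk y -> Ccontinuous (T := C_UniformSpace) k y) ->
  - d < t < 1 + d -> Ccontinuous (T := R_UniformSpace) (fun y => k (P t y)) x.
Proof.
intros Hk Ht; apply (Ccontinuous_comp k (fun y => P t y)); [| apply Hk, homotopy_in_disk, Ht].
apply Ccontinuous_plus; [apply Ccontinuous_const |]; apply Ccontinuous_mult; [apply Ccontinuous_const |].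
apply Ccontinuous_minus; [| apply Ccontinuous_const]; exact (is_curve_derive_Ccontinuous _ _ _ (is_curve_derive_circle rho x)).
Qed.

Let phi (t : R) : R := RInt (fun x => Re (g (P t x) * (c x / (c x - z)))%C) 0 (2 * PI).

Lemma locally_interval (a b t : R) : a < t < b -> locally t (fun s : R => a < s < b).
Proof.
intros H; generalize (filter_and _ _ (open_gt a t (proj1 H)) (open_lt b t (proj2 H))).
apply filter_imp; intros s [A B]; split; assumption.
Qed.

Lemma phi_derive t : - d < t < 1 + d -> is_derive phi t (RInt (fun x => Re (g' (P t x) * c x)%C) 0 (2 * PI)).
Proof.
intros Ht.
assert (CC : forall x, Ccontinuous (T := R_UniformSpace) c x) by (intros x; exact (is_curve_derive_Ccontinuous _ _ _ (is_curve_derive_circle rho x))).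
replace (RInt (fun x => Re (g' (P t x) * c x)%C) 0 (2 * PI))
  with (RInt (fun x => Derive (fun s => Re (g (P s x) * (c x / (c x - z)))%C) t) 0 (2 * PI)).
2: { apply RInt_ext; intros x _; apply is_derive_unique, homotopy_derive_t, Ht. }
apply is_derive_RInt_param.
- generalize (locally_interval _ _ _ Ht); apply filter_imp; intros s Hs x _.
  eexists; apply homotopy_derive_t, Hs.
- intros x _; destruct (locally_interval _ _ _ Ht) as [e He].
  apply continuity_2d_pt_ext_loc with (fun s y => Re (g' (P s y) * c y)%C).
  + exists e; intros s y Hs _; symmetry; apply is_derive_unique, homotopy_derive_t, He, Hs.
  + apply continuity_2d_pt_filterlim.
    apply (homotopy_continuous g' t x); [intros y Hy; apply Hg, Hy | exact Ht].
- generalize (locally_interval _ _ _ Ht); apply filter_imp; intros s Hs.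
  apply (ex_RInt_continuous (V := R_CompleteNormedModule)); intros x _.
  enough (K : Ccontinuous (T := R_UniformSpace) (fun x => g (P s x) * (c x / (c x - z)))%C x) by exact (proj1 K).
  apply Ccontinuous_mult.
  + apply (homotopy_continuous_x g); [intros y Hy; apply is_Cderive_Ccontinuous with (g' y), Hg, Hy | exact Hs].
  + apply Ccontinuous_mult; [apply CC |]; apply Ccontinuous_inv; [apply Ccontinuous_minus; [apply CC | apply Ccontinuous_const] | apply circle_neq].
Qed.

Lemma phi_derivative_zero t : - d < t < 1 + d -> t <> 0 -> RInt (fun x => Re (g' (P t x) * c x)%C) 0 (2 * PI) = 0.
Proof.
intros Ht N; apply Rmult_eq_reg_l with t; [| exact N]; rewrite Rmult_0_r.
assert (CC : forall x, Ccontinuous (T := R_UniformSpace) c x) by (intros x; exact (is_curve_derive_Ccontinuous _ _ _ (is_curve_derive_circle rho x))).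
assert (Cx : forall x, continuous (fun x => Re (g' (P t x) * c x)%C) x).
{ intros x; enough (K : Ccontinuous (T := R_UniformSpace) (fun x => g' (P t x) * c x)%C x) by exact (proj1 K).
  apply Ccontinuous_mult; [| apply CC].
  apply (homotopy_continuous_x g'); [intros y Hy; apply Hg, Hy | exact Ht]. }
rewrite <- (RInt_scal (V := R_CompleteNormedModule)) by (apply (ex_RInt_continuous (V := R_CompleteNormedModule)); intros x _; apply Cx).
rewrite (is_RInt_unique _ _ _ _ (is_RInt_derive (V := R_CompleteNormedModule) (fun y => Re (- Ci * g (P t y))%C) _ _ _
  (fun x _ => homotopy_derive_x t x Ht) (fun x _ => continuous_scal_r t _ x (Cx x)))).
replace (P t (2 * PI)) with (P t 0); [apply Rminus_diag_eq; reflexivity |].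
unfold P, c, cis; rewrite sin_2PI, cos_2PI, sin_0, cos_0; reflexivity.
Qed.

Lemma cauchy_homotopy : RInt (fun x => Re (g (c x) * (c x / (c x - z)))%C) 0 (2 * PI) =
  RInt (fun x => Re (g z * (c x / (c x - z)))%C) 0 (2 * PI).
Proof.
transitivity (phi 1).
{ unfold phi; apply RInt_ext; intros x _; unfold P; replace (z + 1 * (c x - z))%C with (c x) by ring; reflexivity. }
transitivity (phi 0).
2: { unfold phi; apply RInt_ext; intros x _; unfold P; replace (z + 0 * (c x - z))%C with z by ring; reflexivity. }
assert (Hd : 0 < d) by (unfold d; lra).
(* The vanishing of phi' is known only for t <> 0, after cancelling t. The mean value theorem asks
   for it on the open interval alone, and continuity at 0 comes from [phi_derive]. *)
destruct (MVT_gen phi 0 1 (fun _ => 0)) as [xi [_ H]].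
- rewrite Rmin_left, Rmax_right by lra; intros t Ht.
  rewrite <- (phi_derivative_zero t) by lra; apply phi_derive; lra.
- rewrite Rmin_left, Rmax_right by lra; intros t Ht.
  apply derivable_continuous_pt; exists (RInt (fun x => Re (g' (P t x) * c x)%C) 0 (2 * PI)).
  apply is_derive_Reals, phi_derive; lra.
- lra.
Qed.

End Circle.

(** * Taylor expansion and the Schwarz lemma *)

Definition circle_integral (F : R -> C) : C :=
  (RInt (fun x => Re (F x)) 0 (2 * PI), RInt (fun x => Im (F x)) 0 (2 * PI)).

Definition curve_continuous (F : R -> C) : Prop := forall x, Ccontinuous (T := R_UniformSpace) F x.

Lemma curve_continuous_ex_RInt F : curve_continuous F ->
  ex_RInt (fun x => Re (F x)) 0 (2 * PI) /\ ex_RInt (fun x => Im (F x)) 0 (2 * PI).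
Proof.
intros H; split; apply (ex_RInt_continuous (V := R_CompleteNormedModule)); intros x _; apply H.
Qed.

Lemma circle_integral_ext F G : (forall x, F x = G x) -> circle_integral F = circle_integral G.
Proof.
intros H; apply injective_projections; apply RInt_ext; intros x _; rewrite H; reflexivity.
Qed.

Lemma circle_integral_plus F G : curve_continuous F -> curve_continuous G -> circle_integral (fun x => F x + G x)%C = (circle_integral F + circle_integral G)%C.
Proof.
intros HF HG; apply curve_continuous_ex_RInt in HF, HG; apply injective_projections;
  apply (RInt_plus (V := R_CompleteNormedModule)); tauto.
Qed.

Lemma circle_integral_scal k F : curve_continuous F -> circle_integral (fun x => k * F x)%C = (k * circle_integral F)%C.
Proof.
intros HF; apply curve_continuous_ex_RInt in HF; destruct HF as [H1 H2].
apply injective_projections; simpl.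
- transitivity (RInt (fun x => minus (scal (fst k) (Re (F x))) (scal (snd k) (Im (F x)))) 0 (2 * PI)).
  { apply RInt_ext; intros x _; reflexivity. }
  rewrite (RInt_minus (V := R_CompleteNormedModule)), !(RInt_scal (V := R_CompleteNormedModule)); try assumption; try reflexivity;
  apply (ex_RInt_scal (V := R_NormedModule)); assumption.
- transitivity (RInt (fun x => plus (scal (fst k) (Im (F x))) (scal (snd k) (Re (F x)))) 0 (2 * PI)).
  { apply RInt_ext; intros x _; reflexivity. }
  rewrite (RInt_plus (V := R_CompleteNormedModule)), !(RInt_scal (V := R_CompleteNormedModule)); try assumption; try reflexivity;
  apply (ex_RInt_scal (V := R_NormedModule)); assumption.
Qed.

(** The factor is 4 pi instead of 2 pi because real and imaginary parts are estimated separately. *)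
Lemma circle_integral_bound F B : curve_continuous F -> (forall x, 0 <= x <= 2 * PI -> Cmod (F x) <= B) -> Cmod (circle_integral F) <= 4 * PI * B.
Proof.
intros HF HB; apply curve_continuous_ex_RInt in HF; destruct HF as [H1 H2]; pose proof PI_RGT_0.
eapply Rle_trans; [apply Cmod_le_abs |].
replace (4 * PI * B) with ((2 * PI - 0) * B + (2 * PI - 0) * B) by ring.
apply Rplus_le_compat; apply abs_RInt_le_const; try assumption; try lra; intros x Hx.
- eapply Rle_trans; [apply re_le_Cmod | apply HB, Hx].
- eapply Rle_trans; [apply im_le_Cmod | apply HB, Hx].
Qed.

Lemma curve_continuous_Csum (u : nat -> R -> C) n : (forall k, curve_continuous (u k)) -> curve_continuous (fun x => Csum (fun k => u k x) n).
Proof.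
intros H; induction n as [|n IH]; intros x.
- apply Ccontinuous_ext_loc with (u 0%nat); [apply filter_forall; intros y; symmetry; apply Csum_O | apply H].
- apply Ccontinuous_ext_loc with (fun x => Csum (fun k => u k x) n + u (S n) x)%C.
  { apply filter_forall; intros y; symmetry; apply Csum_S. }
  apply Ccontinuous_plus; [apply IH | apply H].
Qed.

Lemma circle_integral_Csum (u : nat -> R -> C) n : (forall k, curve_continuous (u k)) ->
  circle_integral (fun x => Csum (fun k => u k x) n) = Csum (fun k => circle_integral (u k)) n.
Proof.
intros H; induction n as [|n IH].
- rewrite Csum_O; apply circle_integral_ext; intros x; apply Csum_O.
- rewrite Csum_S, <- IH, <- circle_integral_plus; [| apply curve_continuous_Csum, H | apply H].
  apply circle_integral_ext; intros x; apply Csum_S.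
Qed.

Lemma circle_integral_derivative (F F' : R -> C) : (forall x, is_curve_derive F x (F' x)) -> curve_continuous F' -> F 0 = F (2 * PI) -> circle_integral F' = 0.
Proof.
intros HD HC E; apply injective_projections; simpl.
- rewrite (is_RInt_unique _ _ _ _ (is_RInt_derive (V := R_CompleteNormedModule) (fun y => Re (F y)) _ _ _
    (fun x _ => is_curve_derive_Re _ _ _ (HD x)) (fun x _ => proj1 (HC x)))).
  rewrite E; apply Rminus_diag_eq; reflexivity.
- rewrite (is_RInt_unique _ _ _ _ (is_RInt_derive (V := R_CompleteNormedModule) (fun y => Im (F y)) _ _ _
    (fun x _ => is_curve_derive_Im _ _ _ (HD x)) (fun x _ => proj2 (HC x)))).
  rewrite E; apply Rminus_diag_eq; reflexivity.
Qed.

Lemma curve_continuous_bounded F : curve_continuous F -> exists B, 0 <= B /\ forall x, 0 <= x <= 2 * PI -> Cmod (F x) <= B.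
Proof.
intros H.
destruct (continuity_ab_maj (fun x => Re (F x) * Re (F x) + Im (F x) * Im (F x)) 0 (2 * PI)) as [m [Hm _]].
- pose proof PI_RGT_0; lra.
- intros x _; apply continuity_pt_filterlim.
  apply (continuous_plus (fun x => Re (F x) * Re (F x)) (fun x => Im (F x) * Im (F x)));
  apply (continuous_mult (K := R_AbsRing)); apply H.
- exists (Cmod (F m)); split; [apply Cmod_ge_0 |]; intros x Hx; specialize (Hm x Hx).
  unfold Cmod; apply sqrt_le_1_alt; unfold Re, Im in Hm; simpl; lra.
Qed.

Lemma is_Cderive_pow y n : is_Cderive (fun y => y ^ S n)%C y (INR (S n) * y ^ n).
Proof.
induction n as [|n IH].
- replace (INR 1 * y ^ 0)%C with (1 * 1 + y * 0)%C by (simpl; ring).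
  apply (is_Cderive_mult (fun y => y) (fun _ => RtoC 1)); [apply is_Cderive_id | apply is_Cderive_const].
- replace (INR (S (S n)) * y ^ S n)%C with (1 * y ^ S n + y * (INR (S n) * y ^ n))%C.
  + apply (is_Cderive_mult (fun y => y) (fun y => y ^ S n)%C); [apply is_Cderive_id | exact IH].
  + rewrite (S_INR (S n)), RtoC_plus; simpl; ring.
Qed.

(** With an exact remainder only finite sums have to be integrated term by term. *)
Lemma geometric_remainder (c z : C) n : c <> 0 -> (c - z)%C <> 0 ->
  (c / (c - z) = Csum (fun k => z ^ k * (/ c) ^ k) n + z ^ S n * ((/ c) ^ S n * (c / (c - z))))%C.
Proof.
intros Hc Hz; induction n as [|n IH].
- rewrite Csum_O; simpl; field; split; assumption.
- rewrite Csum_S, IH at 1; set (s := Csum _ n).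
  replace (z ^ S (S n) * ((/ c) ^ S (S n) * (c / (c - z))))%C with (z ^ S n * (/ c) ^ S n * (z / (c - z)))%C.
  2: { simpl; field; split; assumption. }
  replace (z ^ S n * ((/ c) ^ S n * (c / (c - z))))%C with (z ^ S n * (/ c) ^ S n * (1 + z / (c - z)))%C by (field; repeat split; assumption).
  ring.
Qed.

Section Taylor.
Context (rho : R) (Hrho : 0 < rho < 1).
Let c (x : R) : C := (rho * cis x)%C.

Lemma circle_mod x : Cmod (c x) = rho.
Proof. apply Cmod_circle; lra. Qed.

Lemma circle_nonzero x : c x <> 0.
Proof. apply Cmod_gt_0; rewrite circle_mod; lra. Qed.

Lemma circle_minus_nonzero z x : Cmod z < rho -> (c x - z)%C <> 0.
Proof. intros Hz; exact (circle_neq z rho (conj Hz (proj2 Hrho)) x). Qed.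

Lemma curve_continuous_circle : curve_continuous c.
Proof. intros x; exact (is_curve_derive_Ccontinuous _ _ _ (is_curve_derive_circle rho x)). Qed.

Lemma curve_continuous_circle_inv_pow n : curve_continuous (fun x => (/ c x) ^ n)%C.
Proof. intros x; apply Ccontinuous_pow, Ccontinuous_inv; [apply curve_continuous_circle | apply circle_nonzero]. Qed.

Lemma curve_continuous_cauchy_kernel z : Cmod z < rho -> curve_continuous (fun x => c x / (c x - z))%C.
Proof.
intros Hz x; apply Ccontinuous_mult; [apply curve_continuous_circle |].
apply Ccontinuous_inv; [apply Ccontinuous_minus; [apply curve_continuous_circle | apply Ccontinuous_const] | apply circle_minus_nonzero, Hz].
Qed.

Lemma kernel_bound z x : Cmod z < rho -> Cmod (c x / (c x - z)) <= rho / (rho - Cmod z).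
Proof.
intros Hz; rewrite Cmod_div by (apply circle_minus_nonzero, Hz); rewrite circle_mod.
apply Rmult_le_compat_l; [lra |]; apply Rinv_le_contravar; [lra |].
assert (H : Cmod (c x) <= Cmod (c x - z) + Cmod z).
{ replace (c x) with (c x - z + z)%C at 1 by ring; apply Cmod_triangle. }
rewrite circle_mod in H; lra.
Qed.

(** Up to the nonzero constant -i (n + 1), the integrand is the derivative of itself, and it is
    periodic. *)
Lemma circle_integral_circle_pow n : circle_integral (fun x => (/ c x) ^ S n)%C = 0.
Proof.
pose proof (circle_nonzero) as N.
assert (E : circle_integral (fun x => (- Ci * INR (S n)) * (/ c x) ^ S n)%C = 0).
{ apply (circle_integral_derivative (fun x => (/ c x) ^ S n)%C).
  - intros x; replace (- Ci * INR (S n) * (/ c x) ^ S n)%C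
      with (INR (S n) * (/ c x) ^ n * (- / (c x * c x) * (Ci * c x)))%C by (simpl; field; apply N).
    apply (is_curve_derive_comp (fun y => y ^ S n)%C (fun x => / c x)%C); [| apply is_Cderive_pow].
    apply (is_curve_derive_comp Cinv c); [apply is_curve_derive_circle | apply is_Cderive_Cinv, N].
  - intros x; apply Ccontinuous_mult; [apply Ccontinuous_const | apply curve_continuous_circle_inv_pow].
  - unfold c, cis; rewrite sin_2PI, cos_2PI, sin_0, cos_0; reflexivity. }
rewrite circle_integral_scal in E by apply curve_continuous_circle_inv_pow.
set (v := circle_integral _) in *.
assert (K : (- Ci * INR (S n))%C <> 0).
{ apply Cmult_neq_0; [intros A; apply Ci_nz; replace Ci with (- - Ci)%C by ring; rewrite A; ring |].
  intros A; apply RtoC_inj in A; pose proof (lt_0_INR (S n) ltac:(lia)); lra. }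
replace v with (/ (- Ci * INR (S n)) * (- Ci * INR (S n) * v))%C.
- rewrite E; ring.
- field; split; [intros A; apply K; rewrite A; ring | exact Ci_nz].
Qed.

Lemma curve_continuous_comp g : (forall y, in_disk y -> Ccontinuous (T := C_UniformSpace) g y) -> curve_continuous (fun x => g (c x)).
Proof.
intros H x; apply (Ccontinuous_comp g c); [apply curve_continuous_circle | apply H]; unfold in_disk; rewrite circle_mod; lra.
Qed.

Lemma holomorphic_Ccontinuous g : holomorphic g -> forall y, in_disk y -> Ccontinuous (T := C_UniformSpace) g y.
Proof. intros [g' H] y Hy; apply is_Cderive_Ccontinuous with (g' y), H, Hy. Qed.

Lemma holomorphic_scal k g : holomorphic g -> holomorphic (fun y => k * g y)%C.
Proof.
intros [g' H]; exists (fun y => k * g' y)%C; intros y Hy; destruct (H y Hy) as [A B]; split.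
- apply is_Cderive_scal, A.
- apply Ccontinuous_mult; [apply Ccontinuous_const | exact B].
Qed.

(** The homotopy argument controls real parts only; applied to -i g, it gives the imaginary
    parts. *)
Lemma cauchy_raw g z : holomorphic g -> Cmod z < rho ->
  circle_integral (fun x => g (c x) * (c x / (c x - z)))%C = (g z * circle_integral (fun x => c x / (c x - z)))%C.
Proof.
intros Hg Hz; rewrite <- circle_integral_scal by (apply curve_continuous_cauchy_kernel, Hz).
assert (Hz' : Cmod z < rho < 1) by lra.
apply injective_projections.
- destruct Hg as [g' Hg]; exact (cauchy_homotopy g g' z rho Hg Hz').
- pose proof (holomorphic_scal (- Ci) g Hg) as [g' Hg'].
  pose proof (cauchy_homotopy _ g' z rho Hg' Hz') as E.
  assert (K : forall w k : C, Re (- Ci * w * k)%C = Im (w * k)%C) by (intros [a b] [a' b']; simpl; ring).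
  simpl; transitivity (RInt (fun x => Re (- Ci * g (c x) * (c x / (c x - z)))%C) 0 (2 * PI));
    [apply RInt_ext; intros x _; symmetry; apply K |].
  etransitivity; [exact E |]; apply RInt_ext; intros x _; apply K.
Qed.

(** Integrating the finite geometric expansion against g leaves an error of at most K q^(n+1) with q
    = |z| / rho. The limit is kept as an integral, since the integral of the kernel is itself
    evaluated by means of this expansion. *)
Lemma cauchy_series_raw g z : holomorphic g -> Cmod z < rho ->
  is_Cseries (fun k => circle_integral (fun x => g (c x) * (/ c x) ^ k) * z ^ k)%C (circle_integral (fun x => g (c x) * (c x / (c x - z)))%C).
Proof.
intros Hg Hz.
pose proof (curve_continuous_comp g (holomorphic_Ccontinuous g Hg)) as RG.
destruct (curve_continuous_bounded _ RG) as [B [B0 HB]].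
assert (RGk : forall k, curve_continuous (fun x => g (c x) * (/ c x) ^ k)%C).
{ intros k x; apply Ccontinuous_mult; [apply RG | apply curve_continuous_circle_inv_pow]. }
assert (RR : forall n, curve_continuous (fun x => g (c x) * ((/ c x) ^ S n * (c x / (c x - z))))%C).
{ intros n x; apply Ccontinuous_mult; [apply RG |]; apply Ccontinuous_mult; [apply curve_continuous_circle_inv_pow | apply curve_continuous_cauchy_kernel, Hz]. }
set (q := Cmod z / rho).
assert (Hq : 0 <= q < 1).
{ pose proof (Cmod_ge_0 z); unfold q; split; [apply Rmult_le_pos; [lra | apply Rlt_le, Rinv_0_lt_compat; lra] |].
  apply Rmult_lt_reg_r with rho; [lra |]; unfold Rdiv; rewrite Rmult_assoc, Rinv_l; lra. }
set (K := 4 * PI * (B * (rho / (rho - Cmod z)))).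
assert (HK : 0 <= K).
{ pose proof PI_RGT_0; unfold K; apply Rmult_le_pos; [lra |]; apply Rmult_le_pos; [exact B0 |].
  apply Rlt_le, Rdiv_lt_0_compat; lra. }
assert (Rem : forall n, Cmod (Csum (fun k => circle_integral (fun x => g (c x) * (/ c x) ^ k) * z ^ k)%C n
    - circle_integral (fun x => g (c x) * (c x / (c x - z)))%C) <= K * q ^ S n).
{ intros n.
  assert (E : circle_integral (fun x => g (c x) * (c x / (c x - z)))%C =
    (Csum (fun k => circle_integral (fun x => g (c x) * (/ c x) ^ k) * z ^ k)%C n
     + z ^ S n * circle_integral (fun x => g (c x) * ((/ c x) ^ S n * (c x / (c x - z)))))%C).
  { transitivity (circle_integral (fun x => Csum (fun k => z ^ k * (g (c x) * (/ c x) ^ k))%C n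
       + z ^ S n * (g (c x) * ((/ c x) ^ S n * (c x / (c x - z)))))%C).
    - apply circle_integral_ext; intros x.
      rewrite (geometric_remainder (c x) z n (circle_nonzero x) (circle_minus_nonzero z x Hz)) at 1.
      assert (D : forall m, (g (c x) * Csum (fun k => z ^ k * (/ c x) ^ k) m)%C = Csum (fun k => z ^ k * (g (c x) * (/ c x) ^ k))%C m).
      { induction m as [|m IH]; [rewrite !Csum_O | rewrite !Csum_S, <- IH]; ring. }
      rewrite <- D; ring.
    - rewrite circle_integral_plus.
      + rewrite (circle_integral_Csum (fun k x => z ^ k * (g (c x) * (/ c x) ^ k))%C).
        2: { intros k x; apply Ccontinuous_mult; [apply Ccontinuous_const | apply RGk]. }
        rewrite (circle_integral_scal (z ^ S n)) by apply RR.
        f_equal; apply Csum_ext; intros k; rewrite circle_integral_scal by apply RGk; ring.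
      + apply curve_continuous_Csum; intros k x; apply Ccontinuous_mult; [apply Ccontinuous_const | apply RGk].
      + intros x; apply Ccontinuous_mult; [apply Ccontinuous_const | apply RR]. }
  rewrite E; set (s := Csum _ n).
  match goal with |- Cmod (s - (s + ?r)) <= _ => replace (s - (s + r))%C with (- r)%C by ring end.
  rewrite Cmod_opp, Cmod_mult, Cmod_pow.
  replace (K * q ^ S n) with (Cmod z ^ S n * (4 * PI * (B * ((/ rho) ^ S n * (rho / (rho - Cmod z)))))).
  2: { unfold K, q, Rdiv; rewrite Rpow_mult_distr; ring. }
  apply Rmult_le_compat_l; [apply pow_le, Cmod_ge_0 |].
  apply circle_integral_bound; [apply RR |]; intros x Hx; rewrite !Cmod_mult, Cmod_pow, Cmod_inv, circle_mod by apply circle_nonzero.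
  apply Rmult_le_compat; [apply Cmod_ge_0 | | apply HB, Hx |].
  - apply Rmult_le_pos; [apply pow_le, Rlt_le, Rinv_0_lt_compat; lra | apply Cmod_ge_0].
  - apply Rmult_le_compat_l; [apply pow_le, Rlt_le, Rinv_0_lt_compat; lra |].
    apply kernel_bound, Hz. }
intros eps He.
destruct (pow_lt_1_zero q ltac:(rewrite Rabs_right; lra) (eps / (K + 1)) ltac:(apply Rdiv_lt_0_compat; lra)) as [N HN].
exists N; intros n Hn; eapply Rle_lt_trans; [apply Rem |].
specialize (HN (S n) ltac:(lia)); rewrite Rabs_right in HN by (apply Rle_ge, pow_le; lra).
pose proof (pow_le q (S n) (proj1 Hq)).
apply Rle_lt_trans with ((K + 1) * q ^ S n); [nra |].
apply Rmult_lt_compat_l with (r := K + 1) in HN; [| lra].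
replace ((K + 1) * (eps / (K + 1))) with eps in HN by (field; lra); exact HN.
Qed.

Lemma holomorphic_const k : holomorphic (fun _ => k).
Proof. exists (fun _ => RtoC 0); intros y _; split; [apply is_Cderive_const | apply Ccontinuous_const]. Qed.

(** The expansion for g = 1: the term k = 0 contributes 2 pi and all others vanish by
    [circle_integral_circle_pow]. *)
Lemma cauchy_kernel_integral z : Cmod z < rho -> circle_integral (fun x => c x / (c x - z))%C = RtoC (2 * PI).
Proof.
intros Hz.
pose proof (cauchy_series_raw (fun _ => 1) z (holomorphic_const 1) Hz) as H.
rewrite (circle_integral_ext _ (fun x => c x / (c x - z))%C) in H by (intros x; ring).
apply (is_Cseries_unique _ _ _ H); apply is_Cseries_ext with (fun k => if Nat.eq_dec k 0 then RtoC (2 * PI) else RtoC 0).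
- intros [|k]; simpl Nat.eq_dec.
  + transitivity (circle_integral (fun _ => RtoC 1)); [| rewrite Cmult_1_r; apply circle_integral_ext; intros x; simpl; ring].
    unfold circle_integral; simpl; rewrite !RInt_const; apply injective_projections; unfold scal; simpl; unfold mult; simpl; ring.
  + rewrite (circle_integral_ext _ (fun x => (/ c x) ^ S k)%C) by (intros x; ring).
    rewrite circle_integral_circle_pow; ring.
- intros eps He; exists 0%nat; intros n _.
  replace (Csum _ n) with (RtoC (2 * PI)); [unfold Cminus; rewrite Cplus_opp_r, Cmod_0; exact He |].
  induction n as [|n IH]; [rewrite Csum_O; reflexivity | rewrite Csum_S, <- IH; simpl Nat.eq_dec; simpl; ring].
Qed.

Lemma cauchy_formula g z : holomorphic g -> Cmod z < rho ->
  circle_integral (fun x => g (c x) * (c x / (c x - z)))%C = (g z * RtoC (2 * PI))%C.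
Proof. intros Hg Hz; rewrite cauchy_raw, cauchy_kernel_integral by assumption; reflexivity. Qed.

Lemma two_PI_nonzero : RtoC (2 * PI) <> 0.
Proof. intros E; apply RtoC_inj in E; pose proof PI_RGT_0; lra. Qed.

Lemma taylor_subdisk g : holomorphic g -> exists a : nat -> C, forall z, Cmod z < rho -> is_Cseries (fun k => a k * z ^ k)%C (g z).
Proof.
intros Hg; exists (fun k => / RtoC (2 * PI) * circle_integral (fun x => g (c x) * (/ c x) ^ k)%C)%C; intros z Hz.
pose proof (cauchy_series_raw g z Hg Hz) as H; rewrite cauchy_formula in H by assumption.
apply (is_Cseries_scal (/ RtoC (2 * PI))) in H.
replace (/ RtoC (2 * PI) * (g z * RtoC (2 * PI)))%C with (g z) in H by (field; apply two_PI_nonzero).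
apply is_Cseries_ext with (2 := H); intros k; ring.
Qed.

Lemma cauchy_bound g z B : holomorphic g -> Cmod z < rho -> (forall y, Cmod y = rho -> Cmod (g y) <= B) ->
  Cmod (g z) <= B * (2 * (rho / (rho - Cmod z))).
Proof.
intros Hg Hz HB; pose proof PI_RGT_0.
apply Rmult_le_reg_r with (2 * PI); [lra |].
rewrite <- (Rabs_right (2 * PI)) at 1 by lra; rewrite <- Cmod_R, <- Cmod_mult, <- cauchy_formula by assumption.
replace (B * (2 * (rho / (rho - Cmod z))) * (2 * PI)) with (4 * PI * (B * (rho / (rho - Cmod z)))) by ring.
apply circle_integral_bound.
- intros x; apply Ccontinuous_mult; [apply (curve_continuous_comp g (holomorphic_Ccontinuous g Hg)) | apply curve_continuous_cauchy_kernel, Hz].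
- intros x _; rewrite Cmod_mult; apply Rmult_le_compat; try apply Cmod_ge_0; [apply HB, circle_mod | apply kernel_bound, Hz].
Qed.

End Taylor.

Lemma is_Cseries_at_0 (a : nat -> C) : is_Cseries (fun k => a k * 0 ^ k)%C (a 0%nat).
Proof.
intros eps He; exists 0%nat; intros n _.
replace (Csum _ n) with (a 0%nat); [replace (a 0%nat - a 0%nat)%C with (RtoC 0) by ring; rewrite Cmod_0; exact He |].
induction n as [|n IH]; [rewrite Csum_O; simpl; ring | rewrite Csum_S, <- IH; simpl; ring].
Qed.

Lemma pseries_value_0 (a : nat -> C) f : (forall z, in_disk z -> is_Cseries (fun k => a k * z ^ k)%C (f z)) -> a 0%nat = f 0.
Proof.
intros H; apply (is_Cseries_unique (fun k => a k * 0 ^ k)%C); [apply is_Cseries_at_0 | apply H].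
unfold in_disk; rewrite Cmod_0; lra.
Qed.

(** Removal of the singularity at 0: the shifted series represents the quotient with the value a 1
    filled in. It serves for w / z, f / z and (psi - 1) / z. *)
Lemma pseries_div (a : nat -> C) (f : C -> C) z : a 0%nat = 0 -> is_Cseries (fun k => a k * z ^ k)%C (f z) ->
  is_Cseries (fun k => a (S k) * z ^ k)%C (if Ceq_dec z 0 then a 1%nat else f z / z)%C.
Proof.
intros A H; destruct (Ceq_dec z 0) as [-> | N]; [apply (is_Cseries_at_0 (fun k => a (S k))) |].
apply is_Cseries_shift in H; simpl in H; rewrite A in H.
apply (is_Cseries_scal (/ z)) in H.
replace (/ z * (f z - 0 * 1))%C with (f z / z)%C in H by (field; exact N).
apply is_Cseries_ext with (2 := H); intros k; field; exact N.
Qed.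

Lemma locally_punctured (P : C -> Prop) (z : C) : locally (T := C_UniformSpace) z P -> exists y, y <> z /\ P y.
Proof.
intros H; apply locally_Cmod in H; destruct H as [d [D1 D2]].
assert (E : (z + RtoC (d / 2) - z)%C = RtoC (d / 2)) by ring.
exists (z + RtoC (d / 2))%C; split.
- intros A; rewrite A in E; replace (z - z)%C with (RtoC 0) in E by ring; apply RtoC_inj in E; lra.
- apply D2; rewrite E, Cmod_R, Rabs_right; lra.
Qed.

Lemma pseries_zero (e : nat -> C) rho : 0 < rho -> (forall z, Cmod z < rho -> is_Cseries (fun k => e k * z ^ k)%C 0) ->
  forall n, e n = 0.
Proof.
intros Hr H n.
assert (P : forall z, Cmod z < rho -> is_Cseries (fun k => e (n + k)%nat * z ^ k)%C 0).
{ induction n as [|n IH]; [exact H |].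
  assert (E0 : e (n + 0)%nat = 0).
  { apply (is_Cseries_unique (fun k => e (n + k)%nat * 0 ^ k)%C); [apply (is_Cseries_at_0 (fun k => e (n + k)%nat)) | apply IH].
    rewrite Cmod_0; exact Hr. }
  set (h := fun z => if Ceq_dec z 0 then e (n + 1)%nat else (0 / z)%C).
  assert (Hh : forall z, Cmod z < rho -> is_Cseries (fun k => e (n + S k)%nat * z ^ k)%C (h z)).
  { intros z Hz; apply (pseries_div (fun k => e (n + k)%nat) (fun _ => 0) z E0), IH, Hz. }
  (* Away from 0 the function h vanishes, and as the sum of a power series it is continuous; hence
     it vanishes at 0 too, which kills the next coefficient. *)
  assert (Hh0 : h 0 = 0).
  { destruct (pseries_derive _ h rho Hh 0 ltac:(rewrite Cmod_0; exact Hr)) as [l [_ Hl]].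
    apply is_Cderive_Ccontinuous in Hl; destruct (Ceq_dec (h 0) 0) as [E | N]; [exact E | exfalso].
    destruct (locally_punctured _ _ (Ccontinuous_nonzero _ _ Hl N)) as [y [Y1 Y2]]; apply Y2.
    unfold h; destruct (Ceq_dec y 0); [contradiction | unfold Cdiv; ring]. }
  intros z Hz; specialize (Hh z Hz); replace (h z) with (RtoC 0) in Hh.
  - apply is_Cseries_ext with (2 := Hh); intros k; rewrite Nat.add_succ_r; reflexivity.
  - unfold h in *; destruct (Ceq_dec z 0) as [_ | _]; [| unfold Cdiv; ring].
    destruct (Ceq_dec 0 0); [symmetry; exact Hh0 | contradiction]. }
rewrite <- (Nat.add_0_r n).
apply (is_Cseries_unique (fun k => e (n + k)%nat * 0 ^ k)%C); [apply (is_Cseries_at_0 (fun k => e (n + k)%nat)) | apply P].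
rewrite Cmod_0; exact Hr.
Qed.

(** The coefficients produced by the Cauchy integral could depend on the circle. Two circles give
    series that agree for |y| < 1/2, so by [pseries_zero] their coefficients coincide, and those of
    radius 1/2 serve everywhere. *)
Theorem holomorphic_taylor g : holomorphic g -> exists a : nat -> C, forall z, in_disk z -> is_Cseries (fun k => a k * z ^ k)%C (g z).
Proof.
intros Hg; destruct (taylor_subdisk (1 / 2) ltac:(lra) g Hg) as [a Ha].
exists a; intros z Hz; unfold in_disk in Hz; pose proof (Cmod_ge_0 z).
set (r := Rmax (1 / 2) ((Cmod z + 1) / 2)).
assert (Hr : 1 / 2 <= r < 1 /\ Cmod z < r).
{ unfold r; pose proof (Rmax_l (1 / 2) ((Cmod z + 1) / 2)); pose proof (Rmax_r (1 / 2) ((Cmod z + 1) / 2)).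
  split; [split; [lra |]; apply Rmax_lub_lt; lra | lra]. }
destruct (taylor_subdisk r ltac:(lra) g Hg) as [b Hb].
assert (E : forall n, (a n + - (1) * b n)%C = 0).
{ apply (pseries_zero (fun n => a n + - (1) * b n)%C (1 / 2)); [lra |]; intros y Hy.
  replace (RtoC 0) with (g y + - (1) * g y)%C by ring.
  apply is_Cseries_ext with (fun k => a k * y ^ k + - (1) * (b k * y ^ k))%C; [intros k; ring |].
  apply is_Cseries_plus; [apply Ha, Hy | apply is_Cseries_scal, Hb; lra]. }
apply is_Cseries_ext with (fun k => b k * z ^ k)%C; [| apply Hb, Hr].
intros k; replace (b k) with (a k + - (1) * b k + - (-(1)) * b k)%C at 1 by (rewrite E; ring).
specialize (E k); replace (a k) with (a k + - (1) * b k + b k)%C by ring; rewrite E; ring.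
Qed.

Lemma pseries_C_derive (a : nat -> C) f : (forall z, in_disk z -> is_Cseries (fun k => a k * z ^ k)%C (f z)) ->
  forall z, in_disk z -> is_Cderive f z (C_derive f z) /\ is_Cseries (fun k => (INR (S k) * a (S k)) * z ^ k)%C (C_derive f z).
Proof.
intros H z Hz; destruct (pseries_derive a f 1 H z Hz) as [l [L1 L2]].
replace (C_derive f z) with l; [split; assumption |].
symmetry; apply is_C_derive_unique, is_Cderive_is_derive, L2.
Qed.

(** Differentiating the derived series once more gives the continuity of the derivative. *)
Lemma pseries_holomorphic (a : nat -> C) f : (forall z, in_disk z -> is_Cseries (fun k => a k * z ^ k)%C (f z)) -> holomorphic f.
Proof.
intros H; exists (C_derive f); intros z Hz; split; [apply (pseries_C_derive a f H z Hz) |].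
destruct (pseries_derive _ (C_derive f) 1 (fun z Hz => proj2 (pseries_C_derive a f H z Hz)) z Hz) as [l [_ L]].
exact (is_Cderive_Ccontinuous _ _ _ L).
Qed.

Lemma holomorphic_mult f g : holomorphic f -> holomorphic g -> holomorphic (fun z => f z * g z)%C.
Proof.
intros [f' Hf] [g' Hg]; exists (fun z => f' z * g z + f z * g' z)%C; intros z Hz.
destruct (Hf z Hz) as [F1 F2], (Hg z Hz) as [G1 G2]; split; [apply is_Cderive_mult; assumption |].
apply Ccontinuous_plus; apply Ccontinuous_mult; try assumption; [exact (is_Cderive_Ccontinuous _ _ _ G1) | exact (is_Cderive_Ccontinuous _ _ _ F1)].
Qed.

Lemma holomorphic_pow f n : holomorphic f -> holomorphic (fun z => f z ^ n)%C.
Proof.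
intros H; induction n as [|n IH]; [exact (holomorphic_const 1) | exact (holomorphic_mult f _ H IH)].
Qed.

(** In place of a maximum principle, Landau's power trick: [cauchy_bound] for the N-th power of G =
    w / z loses a factor 2 rho / (rho - |z|) that does not depend on N, so |G(z)| rho > 1 is
    impossible for large N. Then rho tends to 1. *)
Theorem schwarz (w : C -> C) : holomorphic w -> (forall z, in_disk z -> Cmod (w z) <= 1) -> w 0 = 0 ->
  forall z, in_disk z -> Cmod (w z) <= Cmod z.
Proof.
intros Hw Hb W0 z Hz; unfold in_disk in Hz.
destruct (Ceq_dec z 0) as [-> | Nz]; [rewrite W0; lra |].
pose proof (proj1 (Cmod_gt_0 z) Nz) as Z0.
destruct (holomorphic_taylor w Hw) as [a Ha].
assert (A0 : a 0%nat = 0).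
{ rewrite <- W0; exact (pseries_value_0 a w Ha). }
set (G := fun z => if Ceq_dec z 0 then a 1%nat else (w z / z)%C).
assert (HG : holomorphic G) by (apply (pseries_holomorphic (fun k => a (S k))); intros y Hy; apply pseries_div; [exact A0 | apply Ha, Hy]).
assert (K : forall rho, Cmod z < rho < 1 -> Cmod (G z) * rho <= 1).
{ intros rho Hr; apply Rnot_lt_le; intros L.
  (* N is chosen so that (|G(z)| rho)^N exceeds the factor lost in [cauchy_bound]. *)
  destruct (Pow_x_infinity (Cmod (G z) * rho) ltac:(rewrite Rabs_right; lra) (2 * (rho / (rho - Cmod z)) + 1)) as [N HN].
  specialize (HN N (Nat.le_refl N)); rewrite Rabs_right in HN by (apply Rle_ge, pow_le; lra).
  pose proof (cauchy_bound rho ltac:(lra) _ z ((/ rho) ^ N) (holomorphic_pow G N HG) ltac:(lra)) as CB.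
  rewrite Rpow_mult_distr in HN.
  assert (P : 0 < rho ^ N) by (apply pow_lt; lra).
  assert (CB' : Cmod (G z) ^ N <= (/ rho) ^ N * (2 * (rho / (rho - Cmod z)))).
  { rewrite <- Cmod_pow; apply CB; intros y Hy; rewrite Cmod_pow; apply pow_incr; split; [apply Cmod_ge_0 |].
    unfold G; destruct (Ceq_dec y 0) as [-> | Ny]; [rewrite Cmod_0 in Hy; lra |].
    rewrite Cmod_div, Hy by exact Ny; unfold Rdiv; rewrite <- (Rmult_1_l (/ rho)) at 2.
    apply Rmult_le_compat_r; [apply Rlt_le, Rinv_0_lt_compat; lra | apply Hb; unfold in_disk; lra]. }
  apply Rmult_le_compat_r with (r := rho ^ N) in CB'; [| lra].
  rewrite pow_inv in CB'; replace (/ rho ^ N * (2 * (rho / (rho - Cmod z))) * rho ^ N) with (2 * (rho / (rho - Cmod z))) in CB' by (field; lra).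
  lra. }
assert (G1 : Cmod (G z) <= 1).
{ apply Rnot_lt_le; intros L; set (g := Cmod (G z)) in *.
  (* A radius below 1 that exceeds both |z| and 1 / |G(z)|, so that |G(z)| r > 1. *)
  set (r := Rmax ((1 + Cmod z) / 2) ((1 + / g) / 2)).
  assert (I : 0 < / g < 1) by (split; [apply Rinv_0_lt_compat; lra | rewrite <- Rinv_1; apply Rinv_lt_contravar; lra]).
  assert (R1 : Cmod z < r < 1).
  { unfold r; split; [eapply Rlt_le_trans; [| apply Rmax_l]; lra | apply Rmax_lub_lt; lra]. }
  assert (R2 : / g < r) by (unfold r; eapply Rlt_le_trans; [| apply Rmax_r]; lra).
  specialize (K r R1); apply Rmult_lt_compat_l with (r := g) in R2; [| lra].
  rewrite Rinv_r in R2; lra. }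
unfold G in G1; destruct (Ceq_dec z 0) as [E | _]; [contradiction |].
rewrite Cmod_div in G1 by exact Nz.
apply Rmult_le_compat_r with (r := Cmod z) in G1; [| lra].
unfold Rdiv in G1; rewrite Rmult_assoc, Rinv_l in G1; lra.
Qed.

(** * Exponential, logarithm, square root and inverse hyperbolic tangent *)

Lemma is_Cderive_cauchy_riemann (u v : R -> R -> R) x y a b :
  differentiable_pt_lim u x y a (- b) -> differentiable_pt_lim v x y b a ->
  is_Cderive (fun w => (u (Re w) (Im w), v (Re w) (Im w))) (x, y) (a, b).
Proof.
intros Hu Hv; apply is_Cderive_eps; intros eps He; assert (He2 : 0 < eps / 2) by lra.
destruct (Hu (mkposreal _ He2)) as [d1 H1], (Hv (mkposreal _ He2)) as [d2 H2]; simpl in H1, H2.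
apply locally_Cmod; exists (Rmin d1 d2); split; [apply Rmin_glb_lt; apply cond_pos |].
intros [s t] Hy; set (h := ((s, t) - (x, y))%C) in *.
assert (Es : s - x = Re h) by reflexivity; assert (Et : t - y = Im h) by reflexivity.
pose proof (re_le_Cmod h) as B1; pose proof (im_le_Cmod h) as B2.
pose proof (Rmin_l d1 d2); pose proof (Rmin_r d1 d2).
specialize (H1 s t); specialize (H2 s t); rewrite Es, Et in H1, H2.
specialize (H1 ltac:(lra) ltac:(lra)); specialize (H2 ltac:(lra) ltac:(lra)).
assert (Bm : Rmax (Rabs (Re h)) (Rabs (Im h)) <= Cmod h) by (apply Rmax_lub; assumption).
eapply Rle_trans; [apply Cmod_le_abs |].
replace (eps * Cmod h) with (eps / 2 * Cmod h + eps / 2 * Cmod h) by field.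
assert (Bm' : eps / 2 * Rmax (Rabs (Re h)) (Rabs (Im h)) <= eps / 2 * Cmod h) by (apply Rmult_le_compat_l; lra).
apply Rplus_le_compat.
- eapply Rle_trans; [| exact Bm']; eapply Rle_trans; [| exact H1]; apply Req_le; f_equal.
  simpl; unfold Re, Im; simpl; ring.
- eapply Rle_trans; [| exact Bm']; eapply Rle_trans; [| exact H2]; apply Req_le; f_equal.
  simpl; unfold Re, Im; simpl; ring.
Qed.

Lemma differentiable_pt_lim_prod (f g : R -> R) x y a b :
  derivable_pt_lim f x a -> derivable_pt_lim g y b ->
  differentiable_pt_lim (fun u v => f u * g v) x y (a * g y) (f x * b).
Proof.
intros Hf Hg.
assert (M : differentiable_pt_lim Rmult (f x) (g y) (g y) (f x)).
{ intros eps; exists eps; intros u v Hu Hv.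
  replace (u * v - f x * g y - (g y * (u - f x) + f x * (v - g y))) with ((u - f x) * (v - g y)) by ring.
  rewrite Rabs_mult; apply Rmult_le_compat; try apply Rabs_pos; [lra | apply Rmax_r]. }
replace (a * g y) with (g y * a + f x * 0) by ring; replace (f x * b) with (g y * 0 + f x * b) by ring.
apply (differentiable_pt_lim_comp Rmult (fun u _ => f u) (fun _ v => g v)); [exact M | |].
- exact (differentiable_pt_lim_proj1_0 f x y a Hf).
- intros eps; destruct (differentiable_pt_lim_proj1_0 g y x b Hg eps) as [d Hd]; exists d.
  intros u v Hu Hv; specialize (Hd v u Hv Hu); rewrite Rmax_comm, (Rplus_comm (0 * _)); exact Hd.
Qed.

Lemma is_Cderive_Cexp z : is_Cderive Cexp z (Cexp z).
Proof.
destruct z as [x y]; apply (is_Cderive_cauchy_riemann (fun u v => exp u * cos v) (fun u v => exp u * sin v)); simpl.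
- replace (- (exp x * sin y)) with (exp x * - sin y) by ring.
  apply differentiable_pt_lim_prod; [apply derivable_pt_lim_exp | apply derivable_pt_lim_cos].
- apply differentiable_pt_lim_prod; [apply derivable_pt_lim_exp | apply derivable_pt_lim_sin].
Qed.

Lemma Cexp_plus a b : Cexp (a + b) = (Cexp a * Cexp b)%C.
Proof.
destruct a as [x y], b as [s t]; unfold Cexp; simpl; rewrite exp_plus, cos_plus, sin_plus.
apply injective_projections; simpl; ring.
Qed.

Lemma Cexp_0 : Cexp 0 = 1.
Proof. unfold Cexp; simpl; rewrite exp_0, cos_0, sin_0; apply injective_projections; simpl; ring. Qed.

Lemma Cexp_nonzero z : Cexp z <> 0.
Proof.
intros E; apply C1_nz; rewrite <- Cexp_0; replace (RtoC 0) with (z + - z)%C by ring.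
rewrite Cexp_plus, E; ring.
Qed.

Lemma Cexp_opp z : Cexp (- z) = (/ Cexp z)%C.
Proof.
assert (E : (Cexp z * Cexp (- z))%C = 1) by (rewrite <- Cexp_plus, <- Cexp_0; f_equal; ring).
replace (Cexp (- z)) with (/ Cexp z * (Cexp z * Cexp (- z)))%C by (field; apply Cexp_nonzero).
rewrite E; ring.
Qed.

Lemma Cmod_Cexp z : Cmod (Cexp z) = exp (Re z).
Proof.
unfold Cmod, Cexp; simpl; pose proof (exp_pos (Re z)); pose proof (sin2_cos2 (Im z)) as H0; unfold Rsqr in H0.
replace (exp (Re z) * cos (Im z) * (exp (Re z) * cos (Im z) * 1) + exp (Re z) * sin (Im z) * (exp (Re z) * sin (Im z) * 1))
  with (exp (Re z) * exp (Re z) * (sin (Im z) * sin (Im z) + cos (Im z) * cos (Im z))) by ring.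
rewrite H0, Rmult_1_r; apply sqrt_square; lra.
Qed.

Lemma Cexp_R (x : R) : Cexp x = RtoC (exp x).
Proof. unfold Cexp; simpl; rewrite cos_0, sin_0; apply injective_projections; simpl; ring. Qed.

(* Meaningful on the right half-plane only. *)
Definition Clog (z : C) : C := (ln (Re z * Re z + Im z * Im z) / 2, atan (Im z / Re z)).

Lemma exp_half_ln (s : R) : 0 < s -> exp (ln s / 2) = sqrt s.
Proof.
intros Hs; symmetry; apply sqrt_lem_1; [lra | apply Rlt_le, exp_pos |].
rewrite <- exp_plus; replace (ln s / 2 + ln s / 2) with (ln s) by field; apply exp_ln, Hs.
Qed.

(** For x > 0 one has x^2 + y^2 = x^2 (1 + (y / x)^2), and the root of the second factor cancels the
    denominators of cos (atan (y / x)) and sin (atan (y / x)). *)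
Lemma Cexp_Clog z : 0 < Re z -> Cexp (Clog z) = z.
Proof.
destruct z as [x y]; unfold Cexp, Clog, Re, Im; simpl; intros Hx.
assert (S : x * x + y * y = (x * x) * (1 + (y / x)²)) by (unfold Rsqr; field; lra).
assert (P : 0 < 1 + (y / x)²) by (pose proof (Rle_0_sqr (y / x)); lra).
assert (Q : 0 < sqrt (1 + (y / x)²)) by (apply sqrt_lt_R0, P).
rewrite exp_half_ln by nra; rewrite S, sqrt_mult, sqrt_square by (try lra; nra).
rewrite cos_atan, sin_atan; apply injective_projections; simpl; field; lra.
Qed.

Lemma Ccontinuous_Clog z : 0 < Re z -> Ccontinuous (T := C_UniformSpace) Clog z.
Proof.
destruct z as [x y]; unfold Re; simpl; intros Hx.
assert (CR : continuous (fun w : C_UniformSpace => Re w) (x, y)) by apply Ccontinuous_id.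
assert (CM : continuous (fun w : C_UniformSpace => Im w) (x, y)) by apply (Ccontinuous_id (x, y)).
split; unfold Clog; simpl.
- apply (continuous_mult (K := R_AbsRing)); [| apply continuous_const].
  apply (continuous_comp (fun w : C => Re w * Re w + Im w * Im w) ln).
  + apply (continuous_plus (fun w => Re w * Re w) (fun w => Im w * Im w)); apply (continuous_mult (K := R_AbsRing)); assumption.
  + apply continuity_pt_filterlim, derivable_continuous_pt.
    exists (/ (x * x + y * y)); apply derivable_pt_lim_ln; nra.
- apply (continuous_comp (fun w : C => Im w / Re w) atan).
  + apply (continuous_mult (K := R_AbsRing)); [exact CM |].
    apply (continuous_inv_fun (fun w : C_UniformSpace => Re w)); [exact CR | unfold Re; simpl; lra].
  + apply continuity_pt_filterlim, derivable_continuous_pt, derivable_pt_atan.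
Qed.

Lemma locally_Re_pos z : 0 < Re z -> locally (T := C_UniformSpace) z (fun w => 0 < Re w).
Proof.
intros H; exact (proj1 (Ccontinuous_id z) _ (open_gt 0 (Re z) H)).
Qed.

Lemma is_Cderive_Clog z : 0 < Re z -> is_Cderive Clog z (/ z).
Proof.
intros Hz; rewrite <- (Cexp_Clog z Hz) at 2; apply (is_Cderive_inverse Cexp).
- generalize (locally_Re_pos z Hz); apply filter_imp; intros w; apply Cexp_Clog.
- apply Ccontinuous_Clog, Hz.
- apply is_Cderive_Cexp.
- apply Cexp_nonzero.
Qed.

Lemma Re_bounds w : - Cmod w <= Re w <= Cmod w.
Proof. pose proof (re_le_Cmod w); unfold Rabs in *; destruct Rcase_abs; lra. Qed.

Lemma Re_1_plus w : in_disk w -> 0 < Re (1 + w)%C.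
Proof. unfold in_disk; intros H; rewrite re_plus; pose proof (Re_bounds w); simpl; lra. Qed.

Lemma in_disk_opp w : in_disk w -> in_disk (- w).
Proof. unfold in_disk; rewrite Cmod_opp; auto. Qed.

(** The two roots of t differ by a sign, and the sign of the real part tells them apart. Principal
    roots are identified this way throughout. *)
Lemma Csqrt_unique (q t : C) : (q * q)%C = t -> 0 < Re q -> Csqrt t = q.
Proof.
intros E Hq; destruct (Csqrt_spec t) as [S1 S2].
assert (P : ((Csqrt t - q) * (Csqrt t + q))%C = 0) by (transitivity (Csqrt t * Csqrt t - q * q)%C; [ring | rewrite S1, E; ring]).
destruct (Ceq_dec (Csqrt t - q) 0) as [A | A].
{ replace (Csqrt t) with (Csqrt t - q + q)%C by ring; rewrite A; ring. }
destruct (Ceq_dec (Csqrt t + q) 0) as [B | B]; [| exfalso; exact (Cmult_neq_0 _ _ A B P)].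
assert (R : Re (Csqrt t) = - Re q).
{ replace (Csqrt t) with (Csqrt t + q + - q)%C by ring; rewrite B, re_plus, re_opp; simpl; ring. }
lra.
Qed.

Lemma Re_Csqrt_1_plus w : in_disk w -> 0 < Re (Csqrt (1 + w)).
Proof.
intros Hw; pose proof (Re_1_plus w Hw) as P; destruct (Csqrt_spec (1 + w)) as [S [A | [A _]]]; [exact A | exfalso].
rewrite <- S, re_mult, A in P; nra.
Qed.

(** Halving an argument in (-pi/2, pi/2) keeps the real part positive, so this root is the principal
    one. The formula makes the square root holomorphic. *)
Lemma Csqrt_exp_log w : in_disk w -> Csqrt (1 + w) = Cexp (/ 2 * Clog (1 + w)).
Proof.
intros Hw; apply Csqrt_unique.
- rewrite <- Cexp_plus; replace (/ 2 * Clog (1 + w) + / 2 * Clog (1 + w))%C with (Clog (1 + w)) by field.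
  apply Cexp_Clog, Re_1_plus, Hw.
- unfold Cexp; simpl; apply Rmult_lt_0_compat; [apply exp_pos |].
  (* Here [/ 2] is a complex inverse, whose unfolding divides by |2|^2 = 4. *)
  replace (/ (2 * (2 * 1) + 0 * (0 * 1))) with (/ 4) by field.
  pose proof (atan_bound (Im (1 + w) / Re (1 + w))) as B; unfold Clog; simpl.
  set (a := atan _) in *; apply cos_gt_0.
  + match goal with |- - (PI / 2) < ?X => replace X with (a / 2) by (unfold a; field) end; lra.
  + match goal with |- ?X < PI / 2 => replace X with (a / 2) by (unfold a; field) end; lra.
Qed.

Definition Cartanh (w : C) : C := (/ 2 * (Clog (1 + w) - Clog (1 + - w)))%C.

Lemma one_plus_nonzero w : in_disk w -> (1 + w)%C <> 0.
Proof. intros Hw E; pose proof (Re_1_plus w Hw) as P; rewrite E in P; simpl in P; lra. Qed.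

Lemma is_Cderive_Cartanh w : in_disk w -> is_Cderive Cartanh w (/ (1 - w * w)).
Proof.
intros Hw; pose proof (in_disk_opp w Hw) as Hw'.
pose proof (one_plus_nonzero w Hw) as N1; pose proof (one_plus_nonzero _ Hw') as N2.
replace (/ (1 - w * w))%C with (/ 2 * (/ (1 + w) * (0 + 1) + - (1) * (/ (1 + - w) * (0 + - (1) * 1))))%C.
2: { replace (1 - w * w)%C with ((1 + w) * (1 + - w))%C by ring; field; split; assumption. }
apply (is_Cderive_scal (/ 2) (fun w => Clog (1 + w) - Clog (1 + - w))%C).
apply is_Cderive_ext_loc with (fun w => Clog (1 + w) + - (1) * Clog (1 + - (1) * w))%C.
{ apply filter_forall; intros y; replace (- (1) * y)%C with (- y)%C by ring; ring. }
apply is_Cderive_plus.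
- apply (is_Cderive_comp (fun w => 1 + w)%C Clog); [apply is_Cderive_plus; [apply is_Cderive_const | apply is_Cderive_id] | apply is_Cderive_Clog, Re_1_plus, Hw].
- apply is_Cderive_scal, (is_Cderive_comp (fun w => 1 + - (1) * w)%C Clog).
  + apply is_Cderive_plus; [apply is_Cderive_const | apply is_Cderive_scal, is_Cderive_id].
  + replace (1 + - w)%C with (1 + - (1) * w)%C by ring; apply is_Cderive_Clog.
    replace (- (1) * w)%C with (- w)%C by ring; apply Re_1_plus, Hw'.
Qed.

(** Pairing u with the conjugate of its increment d reduces to the real mean value theorem: g |d| -
    Re (conj d * u) has nonnegative derivative, and its increment is (g 1 - g 0) |d| - |d|^2. *)
Lemma curve_growth (u u' : R -> C) (g g' : R -> R) :
  (forall t, 0 <= t <= 1 -> is_curve_derive u t (u' t)) -> (forall t, 0 <= t <= 1 -> is_derive g t (g' t)) ->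
  (forall t, 0 <= t <= 1 -> Cmod (u' t) <= g' t) -> Cmod (u 1 - u 0) <= g 1 - g 0.
Proof.
intros Hu Hg H; set (d := (u 1 - u 0)%C).
assert (K : forall t, 0 <= t <= 1 -> is_derive (fun t => g t * Cmod d - Re (Cconj d * u t)%C) t (g' t * Cmod d - Re (Cconj d * u' t)%C)).
{ intros t Ht; apply (is_derive_minus (K := R_AbsRing) (V := R_NormedModule) (fun t => g t * Cmod d) (fun t => Re (Cconj d * u t)%C)).
  - apply is_derive_ext with (fun t => Cmod d * g t); [intros s; apply Rmult_comm |].
    rewrite Rmult_comm; apply is_derive_scal, Hg, Ht.
  - apply (is_curve_derive_Re (fun t => Cconj d * u t)%C), is_curve_derive_scal, Hu, Ht. }
destruct (MVT_gen (fun t => g t * Cmod d - Re (Cconj d * u t)%C) 0 1 (fun t => g' t * Cmod d - Re (Cconj d * u' t)%C)) as [s [Hs E]].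
{ rewrite Rmin_left, Rmax_right by lra; intros t Ht; apply K; lra. }
{ rewrite Rmin_left, Rmax_right by lra; intros t Ht.
  apply derivable_continuous_pt; exists (g' t * Cmod d - Re (Cconj d * u' t)%C); apply is_derive_Reals, K, Ht. }
rewrite Rmin_left, Rmax_right in Hs by lra.
assert (P : Re (Cconj d * u' s)%C <= g' s * Cmod d).
{ eapply Rle_trans; [apply Re_bounds |]; rewrite Cmod_mult, Cmod_conj, Rmult_comm.
  apply Rmult_le_compat_r; [apply Cmod_ge_0 | apply H, Hs]. }
assert (D : Re (Cconj d * u 1)%C - Re (Cconj d * u 0)%C = Cmod d ^ 2).
{ replace (Cmod d ^ 2) with (Re (RtoC (Cmod d ^ 2))) by reflexivity.
  rewrite Cmod2_conj; replace (d * Cconj d)%C with (Cconj d * u 1 - Cconj d * u 0)%C by (unfold d; ring).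
  unfold Cminus; rewrite re_plus, re_opp; reflexivity. }
pose proof (Cmod_ge_0 d) as D0.
assert (G : 0 <= (g 1 - g 0) * Cmod d - Cmod d ^ 2) by lra.
(* For d = 0 nothing can be divided out; g 0 <= g 1 then follows from g' >= |u'| >= 0. *)
destruct (Rle_lt_or_eq_dec _ _ D0) as [D1 | D1]; [nra |].
rewrite <- D1.
destruct (MVT_gen g 0 1 g') as [r [Hr E']].
{ rewrite Rmin_left, Rmax_right by lra; intros t Ht; apply Hg; lra. }
{ rewrite Rmin_left, Rmax_right by lra; intros t Ht; apply derivable_continuous_pt; exists (g' t); apply is_derive_Reals, Hg, Ht. }
rewrite Rmin_left, Rmax_right in Hr by lra.
pose proof (H r Hr); pose proof (Cmod_ge_0 (u' r)); lra.
Qed.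

(** Along the ray t w the speed |w| exp (t Re w) is at most |w| exp (t |w|). Equality on the
    positive axis is what makes the exponential radius sharp. *)
Lemma Cmod_Cexp_minus_1 w : Cmod (Cexp w - 1) <= exp (Cmod w) - 1.
Proof.
pose proof (curve_growth (fun t => Cexp (0 + t * w)) (fun t => Cexp (0 + t * w) * w)%C
  (fun t => exp (t * Cmod w)) (fun t => Cmod w * exp (t * Cmod w))) as H.
cbv beta in H; replace (0 + 1 * w)%C with w in H by ring; replace (0 + 0 * w)%C with (RtoC 0) in H by ring.
rewrite Cexp_0, Rmult_1_l, Rmult_0_l, exp_0 in H; apply H; intros t Ht.
- apply (is_curve_derive_comp Cexp (fun t => 0 + t * w)%C); [apply is_curve_derive_line | apply is_Cderive_Cexp].
- auto_derive; [trivial | ring].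
- rewrite Cmod_mult, Cmod_Cexp, Rmult_comm; apply Rmult_le_compat_l; [apply Cmod_ge_0 |].
  replace (Re (0 + t * w)) with (t * Re w) by (rewrite re_plus, re_scal_l; simpl; ring).
  assert (B : t * Re w <= t * Cmod w) by (apply Rmult_le_compat_l; [lra | apply Re_bounds]).
  destruct B as [B | B]; [left; apply exp_increasing, B | right; rewrite B; reflexivity].
Qed.

(** This is tanh 1, with numerator and denominator multiplied by e so as to match the powers of e in
    the radii. *)
Definition tanh1 : R := (exp 1 ^ 2 - 1) / (exp 1 ^ 2 + 1).

Lemma tanh1_bounds : 0 < tanh1 < 1.
Proof.
pose proof (exp_ineq1 1 ltac:(lra)) as E; unfold tanh1.
assert (P : 1 < exp 1 ^ 2) by nra.
split; [apply Rdiv_lt_0_compat; lra |].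
apply Rmult_lt_reg_r with (exp 1 ^ 2 + 1); [lra |]; unfold Rdiv; rewrite Rmult_assoc, Rinv_l; lra.
Qed.

(* |w / (1 - t^2 w^2)| <= |w| / (1 - t^2 |w|^2) on the ray t w, hence |artanh w| <= artanh |w|. *)
Lemma Cartanh_lt_1 w : Cmod w < tanh1 -> in_disk (Cartanh w).
Proof.
intros Hw; pose proof tanh1_bounds as TB; pose proof (Cmod_ge_0 w) as W0; unfold in_disk.
set (r := Cmod w) in *.
assert (D : forall t, 0 <= t <= 1 -> 0 <= t * r < 1) by (intros t Ht; nra).
assert (H : Cmod (Cartanh w - 0) <= / 2 * (ln (1 + r) - ln (1 - r)) - 0).
{ pose proof (curve_growth (fun t => Cartanh (0 + t * w)) (fun t => / (1 - (0 + t * w) * (0 + t * w)) * w)%C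
    (fun t => / 2 * (ln (1 + t * r) - ln (1 - t * r))) (fun t => / (1 - (t * r) * (t * r)) * r)) as H.
  cbv beta in H; replace (0 + 1 * w)%C with w in H by ring; replace (0 + 0 * w)%C with (RtoC 0) in H by ring.
  replace (Cartanh 0) with (RtoC 0) in H.
  2: { unfold Cartanh; replace (1 + - 0)%C with (1 + 0)%C by ring; ring. }
  rewrite Rmult_1_l, Rmult_0_l, Rplus_0_r, Rminus_0_r, ln_1, Rminus_0_r, Rmult_0_r in H.
  apply H; intros t Ht; specialize (D t Ht).
  - apply (is_curve_derive_comp Cartanh (fun t => 0 + t * w)%C); [apply is_curve_derive_line |].
    apply is_Cderive_Cartanh; unfold in_disk; replace (0 + t * w)%C with (t * w)%C by ring.
    rewrite Cmod_mult, Cmod_R, Rabs_right by lra; apply D.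
  - auto_derive; [lra |]; field; nra.
  - replace (0 + t * w)%C with (t * w)%C by ring.
    assert (Q : Cmod (t * w * (t * w)) = t * r * (t * r)) by (rewrite !Cmod_mult, Cmod_R, Rabs_right by lra; reflexivity).
    assert (L : 1 - t * r * (t * r) <= Cmod (1 - t * w * (t * w))).
    { pose proof (Cmod_triangle (1 - t * w * (t * w)) (t * w * (t * w))) as T.
      replace (1 - t * w * (t * w) + t * w * (t * w))%C with (RtoC 1) in T by ring.
      rewrite Cmod_1, Q in T; lra. }
    assert (P : 0 < 1 - t * r * (t * r)) by nra.
    rewrite Cmod_mult, Cmod_inv by (apply Cmod_gt_0; lra).
    apply Rmult_le_compat_r; [exact W0 |]; apply Rinv_le_contravar; assumption. }
replace (Cartanh w - 0)%C with (Cartanh w) in H by ring.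
eapply Rle_lt_trans; [exact H |].
(* Half the difference of the logarithms is below 1 exactly when 1 + r < e^2 (1 - r), that is, when
   r < tanh 1. *)
assert (E : ln (1 + r) < ln (exp 2 * (1 - r))).
{ apply ln_increasing; [lra |].
  replace (exp 2) with (exp 1 ^ 2) by (simpl; rewrite Rmult_1_r, <- exp_plus; f_equal; ring).
  pose proof (exp_pos 1) as E0; unfold tanh1 in Hw.
  apply Rmult_lt_compat_r with (r := exp 1 ^ 2 + 1) in Hw; [| nra].
  unfold Rdiv in Hw; rewrite Rmult_assoc, Rinv_l in Hw by nra; lra. }
rewrite ln_mult, ln_exp in E by (try apply exp_pos; lra); lra.
Qed.

(** With v = artanh w, exp (2 v) = (1 + w) / (1 - w) gives tanh v = w; the sign of Re q selects the
    root. *)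
Lemma Bfun_Cartanh q w : in_disk w -> (q * q)%C = (1 + w)%C -> 0 < Re q -> Bfun (Cartanh w) = q.
Proof.
intros Hw E Hq; unfold Bfun; apply Csqrt_unique; [| exact Hq]; rewrite E; f_equal.
pose proof (one_plus_nonzero w Hw) as N1; pose proof (one_plus_nonzero _ (in_disk_opp w Hw)) as N2.
set (v := Cartanh w); unfold Ctanh; rewrite Cexp_opp.
assert (S : (Cexp v * Cexp v)%C = ((1 + w) / (1 + - w))%C).
{ rewrite <- Cexp_plus; replace (v + v)%C with (Clog (1 + w) + - Clog (1 + - w))%C by (unfold v, Cartanh; field).
  rewrite Cexp_plus, Cexp_opp, !Cexp_Clog; [reflexivity | apply Re_1_plus, in_disk_opp, Hw | apply Re_1_plus, Hw]. }
pose proof (Cexp_nonzero v) as N.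
assert (T2 : RtoC 2 <> 0) by (intros A; apply RtoC_inj in A; lra).
assert (A1 : (Cexp v - / Cexp v)%C = (/ Cexp v * (2 * w / (1 + - w)))%C).
{ transitivity (/ Cexp v * (Cexp v * Cexp v - 1))%C; [field; exact N | rewrite S; field; split; assumption]. }
assert (A2 : (Cexp v + / Cexp v)%C = (/ Cexp v * (2 / (1 + - w)))%C).
{ transitivity (/ Cexp v * (Cexp v * Cexp v + 1))%C; [field; exact N | rewrite S; field; split; assumption]. }
rewrite A1, A2; field; repeat split; assumption.
Qed.

(** If tanh v = s tanh 1 then exp (2 v) = exp (2 s). In the unit disk |Im (2 v)| < 2 < pi, so v is
    real and equals s, which lies on the boundary. Squares are compared so that no branch enters. *)
Lemma Bfun_avoids v (s : R) : in_disk v -> s = 1 \/ s = -1 ->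
  (Bfun v * Bfun v)%C <> RtoC (1 + s * tanh1).
Proof.
intros Hv Hs E; unfold Bfun in E; rewrite (proj1 (Csqrt_spec _)) in E.
pose proof tanh1_bounds as TB; pose proof (Cexp_nonzero v) as N.
assert (T : Ctanh v = RtoC (s * tanh1)).
{ replace (Ctanh v) with (1 + Ctanh v - 1)%C by ring; rewrite E, RtoC_plus; ring. }
unfold Ctanh in T; rewrite Cexp_opp in T.
assert (S : Cexp (v + v) = RtoC (exp (s + s))).
{ rewrite Cexp_plus; set (w := Cexp v) in *.
  destruct (Ceq_dec (w + / w) 0) as [Z | Z].
  (* At a zero of cosh the quotient [Ctanh] takes the default value 0, since the inverse of 0 is 0;
     this differs from s tanh 1. *)
  { rewrite Z in T; unfold Cdiv in T; replace (/ 0)%C with (RtoC 0) in T.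
    - rewrite Cmult_0_r in T; apply RtoC_inj in T; destruct Hs as [-> | ->]; lra.
    - unfold Cinv; simpl; apply injective_projections; simpl; unfold Rdiv; ring. }
  assert (T' : ((w * w - 1)%C = RtoC (s * tanh1) * (w * w + 1))%C).
  { transitivity (w * (w - / w))%C; [field; exact N |].
    transitivity (w * (RtoC (s * tanh1) * (w + / w)))%C; [| field; exact N].
    rewrite <- T; field; split; [exact N |]. 
    intros A; apply Z; replace (w + / w)%C with ((w * w + 1) / w)%C by (field; exact N); rewrite A; unfold Cdiv; ring. }
  assert (T'' : (w * w * RtoC (1 - s * tanh1))%C = RtoC (1 + s * tanh1)).
  { rewrite RtoC_minus, RtoC_plus; set (k := RtoC (s * tanh1)) in *; transitivity (w * w - 1 - k * (w * w + 1) + (1 + k))%C; [ring | rewrite T'; ring]. }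
  assert (P : 1 - s * tanh1 <> 0) by (destruct Hs as [-> | ->]; lra).
  transitivity (w * w * RtoC (1 - s * tanh1) / RtoC (1 - s * tanh1))%C.
  { field; intros A; apply RtoC_inj in A; contradiction. }
  rewrite T'', <- RtoC_div by exact P; f_equal.
  pose proof (exp_pos 1) as E1.
  assert (E2 : exp 1 * exp (-1) = 1) by (rewrite <- exp_plus; replace (1 + -1) with 0 by ring; apply exp_0).
  unfold tanh1; destruct Hs as [-> | ->]; rewrite exp_plus.
  - field; split; [nra |]; intros A; assert (2 = 0) by (rewrite <- A; ring); lra.
  - assert (E3 : exp (-1) = / exp 1) by (apply Rmult_eq_reg_l with (exp 1); [rewrite Rinv_r |]; lra).
    rewrite E3; field; repeat split; nra. }
assert (S1 : exp (Re v + Re v) * cos (Im v + Im v) = exp (s + s)) by exact (f_equal fst S).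
assert (S2 : exp (Re v + Re v) * sin (Im v + Im v) = 0) by exact (f_equal snd S).
pose proof (exp_pos (Re v + Re v)) as EP; pose proof PI2_1 as HPI.
pose proof (im_le_Cmod v) as B2; pose proof (Re_bounds v) as B1; unfold in_disk in Hv.
assert (B3 : - 1 < Im v < 1) by (unfold Rabs in B2; destruct Rcase_abs in B2; lra).
assert (I0 : Im v = 0).
{ destruct (Rtotal_order (Im v) 0) as [L | [L | L]]; [exfalso | exact L | exfalso].
  - assert (0 < sin (- (Im v + Im v))) by (apply sin_gt_0; lra); rewrite sin_neg in *; nra.
  - assert (0 < sin (Im v + Im v)) by (apply sin_gt_0; lra); nra. }
rewrite I0, Rplus_0_r, cos_0, Rmult_1_r in S1; apply exp_inv in S1.
destruct Hs; lra.
Qed.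

(** * Starlike functions, dilations and extremal functions *)

Lemma in_disk_0 : in_disk 0.
Proof. unfold in_disk; rewrite Cmod_0; lra. Qed.

Lemma holomorphic_ext f g : (forall z, in_disk z -> f z = g z) -> holomorphic f -> holomorphic g.
Proof.
intros E [f' H]; exists f'; intros z Hz; destruct (H z Hz) as [A B]; split; [| exact B].
apply is_Cderive_ext_loc with (2 := A); apply filter_imp with (2 := locally_disk 1 z Hz); exact E.
Qed.

Lemma holomorphic_id : holomorphic (fun z => z).
Proof. exists (fun _ => RtoC 1); intros z _; split; [apply is_Cderive_id | apply Ccontinuous_const]. Qed.

Lemma holomorphic_plus f g : holomorphic f -> holomorphic g -> holomorphic (fun z => f z + g z)%C.
Proof.
intros [f' Hf] [g' Hg]; exists (fun z => f' z + g' z)%C; intros z Hz.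
destruct (Hf z Hz), (Hg z Hz); split; [apply is_Cderive_plus | apply Ccontinuous_plus]; assumption.
Qed.

Lemma holomorphic_inv f : holomorphic f -> (forall z, in_disk z -> f z <> 0) -> holomorphic (fun z => / f z)%C.
Proof.
intros [f' Hf] N; exists (fun z => - / (f z * f z) * f' z)%C; intros z Hz; destruct (Hf z Hz) as [A B].
specialize (N z Hz); pose proof (is_Cderive_Ccontinuous _ _ _ A) as K; split.
- apply (is_Cderive_comp f Cinv); [exact A | apply is_Cderive_Cinv, N].
- apply Ccontinuous_mult; [| exact B]; apply Ccontinuous_opp, Ccontinuous_inv; [apply Ccontinuous_mult; exact K | apply Cmult_neq_0; exact N].
Qed.

Lemma holomorphic_Cexp f : holomorphic f -> holomorphic (fun z => Cexp (f z)).
Proof.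
intros [f' Hf]; exists (fun z => Cexp (f z) * f' z)%C; intros z Hz; destruct (Hf z Hz) as [A B].
pose proof (is_Cderive_comp f Cexp _ _ _ A (is_Cderive_Cexp (f z))) as K; split; [exact K |].
apply Ccontinuous_mult; [exact (is_Cderive_Ccontinuous _ _ _ K) | exact B].
Qed.

Lemma holomorphic_analytic f : holomorphic f -> analytic_on_disk f.
Proof. intros [f' H] z Hz; exists (f' z); apply is_Cderive_is_derive, H, Hz. Qed.

Lemma classS_nonzero f z : classS f -> in_disk z -> z <> 0 -> f z <> 0.
Proof.
intros [[_ [a [A0 [_ Ha]]]] Inj] Hz N E; apply N, Inj; [exact Hz | apply in_disk_0 |].
rewrite E, <- (pseries_value_0 a f); [symmetry; exact A0 |].
intros y Hy; apply is_pseries_is_Cseries, Ha, Hy.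
Qed.

(** Writing f = z u, univalence and u(0) = 1 make u zero-free, and z f'/f = 1 + z u'/u has no
    singularity left. *)
Lemma starlike_quotient_holomorphic f : classS f -> holomorphic (starlike_quotient f).
Proof.
intros Hf; pose proof Hf as [[_ [a [A0 [A1 Ha]]]] _].
assert (Ha' : forall z, in_disk z -> is_Cseries (fun k => a k * z ^ k)%C (f z)) by (intros z Hz; apply is_pseries_is_Cseries, Ha, Hz).
set (u := fun z => if Ceq_dec z 0 then a 1%nat else (f z / z)%C).
assert (Su : forall z, in_disk z -> is_Cseries (fun k => a (S k) * z ^ k)%C (u z)) by (intros z Hz; apply pseries_div; [exact A0 | apply Ha', Hz]).
assert (Nu : forall z, in_disk z -> u z <> 0).
{ intros z Hz; unfold u; destruct (Ceq_dec z 0) as [_ | N]; [rewrite A1; exact C1_nz |].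
  intros E; apply (classS_nonzero f z Hf Hz N); replace (f z) with (f z / z * z)%C by (field; exact N); rewrite E; ring. }
assert (Fu : forall z, in_disk z -> (z * u z)%C = f z).
{ intros z Hz; unfold u; destruct (Ceq_dec z 0) as [-> | N]; [| field; exact N].
  rewrite Cmult_0_l, <- (pseries_value_0 a f Ha'); symmetry; exact A0. }
apply holomorphic_ext with (fun z => 1 + z * (C_derive u z * / u z))%C.
- intros z Hz; unfold starlike_quotient; destruct (Ceq_dec z 0) as [-> | N]; [ring |].
  assert (D : is_Cderive f z (1 * u z + z * C_derive u z)).
  { apply is_Cderive_ext_loc with (fun z => z * u z)%C; [apply filter_imp with (2 := locally_disk 1 z Hz); exact Fu |].
    apply (is_Cderive_mult (fun z => z)); [apply is_Cderive_id | apply (pseries_C_derive _ u Su z Hz)]. }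
  rewrite (is_C_derive_unique _ _ _ (proj1 (is_Cderive_is_derive _ _ _) D)), <- (Fu z Hz); field.
  split; [apply Nu, Hz | exact N].
- apply holomorphic_plus; [apply holomorphic_const |]; apply holomorphic_mult; [apply holomorphic_id |]; apply holomorphic_mult.
  + apply (pseries_holomorphic _ (C_derive u) (fun z Hz => proj2 (pseries_C_derive _ u Su z Hz))).
  + apply holomorphic_inv; [exact (pseries_holomorphic _ u Su) | exact Nu].
Qed.

Section Dilation.
Context (f : C -> C) (r : R) (Hf : classS f) (Hr : 0 < r <= 1).

Lemma in_disk_scal z : in_disk z -> in_disk (r * z)%C.
Proof.
unfold in_disk; intros Hz; rewrite Cmod_mult, Cmod_R, Rabs_right by lra; pose proof (Cmod_ge_0 z); nra.
Qed.

Lemma RtoC_r_nonzero : RtoC r <> 0.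
Proof. intros E; apply RtoC_inj in E; lra. Qed.

Lemma dilation_derive z : in_disk z -> is_Cderive (dilation r f) z (C_derive f (r * z)).
Proof.
intros Hz; destruct Hf as [[An _] _].
assert (D : is_Cderive f (r * z)%C (C_derive f (r * z))) by (apply is_Cderive_is_derive, C_derive_correct; [exact z | apply An, in_disk_scal, Hz]).
assert (L : is_Cderive (fun z => r * z)%C z (r * 1)) by apply is_Cderive_scal, is_Cderive_id.
pose proof (is_Cderive_scal (/ r)%C _ _ _ (is_Cderive_comp (fun z => r * z)%C f z _ _ L D)) as K.
replace (/ r * (C_derive f (r * z) * (r * 1)))%C with (C_derive f (r * z)) in K by (field; apply RtoC_r_nonzero).
apply is_Cderive_ext_loc with (2 := K); apply filter_forall; intros y; unfold dilation, Cdiv; ring.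
Qed.

Lemma dilation_classS : classS (dilation r f).
Proof.
pose proof Hf as [[_ [a [A0 [A1 Ha]]]] Inj]; split; [split |].
- intros z Hz; exists (C_derive f (r * z)); apply is_Cderive_is_derive, dilation_derive, Hz.
(* The coefficients a n r^(n-1), written without subtraction in the exponent. *)
- exists (fun n => / r * (a n * r ^ n))%C; split; [rewrite A0; ring |]; split.
  + rewrite A1; field; apply RtoC_r_nonzero.
  + intros z Hz; apply is_pseries_is_Cseries.
    replace (dilation r f z) with (/ r * f (r * z))%C by (unfold dilation, Cdiv; ring).
    apply is_Cseries_ext with (fun k => / r * (a k * (r * z) ^ k))%C; [intros k; rewrite Cpow_mult_l; ring |].
    apply is_Cseries_scal, is_pseries_is_Cseries, Ha, in_disk_scal, Hz.
- intros z1 z2 H1 H2 E; unfold dilation in E.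
  assert (E' : f (r * z1)%C = f (r * z2)%C).
  { replace (f (r * z1)%C) with (f (r * z1) / r * r)%C by (field; apply RtoC_r_nonzero); rewrite E; field; apply RtoC_r_nonzero. }
  apply Inj in E'; try (apply in_disk_scal; assumption).
  replace z1 with (/ r * (r * z1))%C by (field; apply RtoC_r_nonzero); rewrite E'; field; apply RtoC_r_nonzero.
Qed.

Lemma dilation_starlike_quotient z : in_disk z -> starlike_quotient (dilation r f) z = starlike_quotient f (r * z).
Proof.
intros Hz; unfold starlike_quotient.
destruct (Ceq_dec z 0) as [-> | N].
{ destruct (Ceq_dec (r * 0) 0) as [_ | N]; [reflexivity | exfalso; apply N; ring]. }
assert (N' : (r * z)%C <> 0) by (apply Cmult_neq_0; [apply RtoC_r_nonzero | exact N]).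
destruct (Ceq_dec (r * z) 0) as [E | _]; [contradiction |].
rewrite (is_C_derive_unique _ _ _ (proj1 (is_Cderive_is_derive _ _ _) (dilation_derive z Hz))).
unfold dilation; field; split; [| apply RtoC_r_nonzero].
apply classS_nonzero; [exact Hf | apply in_disk_scal, Hz | exact N'].
Qed.

End Dilation.

(** The part common to both classes. The second hypothesis recovers the regularity of w from that of
    the starlike quotient psi(w); it is left open because each psi is undone in its own way. *)
Lemma tanh_disk_admissible (psi : C -> C) (rho : R) : 0 < rho <= 1 ->
  (forall w, analytic_on_disk w -> (forall z, in_disk z -> in_disk (w z)) -> holomorphic (fun z => psi (w z)) -> holomorphic w) ->
  (forall z, Cmod z < rho -> 0 < Re (psi z) /\ Cmod (psi z * psi z - 1) < tanh1) ->
  admissible_radius (Sstar psi) rho.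
Proof.
intros Hrho HW Hpsi; split; [exact Hrho |].
intros f [Hf [w [W1 [W2 [W3 W4]]]]] r Hr.
assert (Hr1 : 0 < r <= 1) by lra.
pose proof (starlike_quotient_holomorphic f Hf) as Hq.
assert (Hw : holomorphic w) by (apply HW; try assumption; apply holomorphic_ext with (2 := Hq); exact W4).
split; [apply dilation_classS; assumption |].
set (q := starlike_quotient f) in *.
set (T := fun z => (q z * q z + - (1))%C).
assert (HT : holomorphic T) by (apply holomorphic_plus; [apply holomorphic_mult; assumption | apply holomorphic_const]).
assert (G : forall z, in_disk z -> 0 < Re (q (r * z)%C) /\ Cmod (T (r * z)%C) < tanh1).
{ intros z Hz; pose proof (in_disk_scal r Hr1 z Hz) as Hz'.
  unfold T; rewrite W4 by exact Hz'; apply Hpsi.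
  eapply Rle_lt_trans; [apply (schwarz w Hw); [intros y Hy; apply Rlt_le, W2, Hy | exact W3 | exact Hz'] |].
  unfold in_disk in Hz; rewrite Cmod_mult, Cmod_R, Rabs_right by lra; nra. }
pose proof tanh1_bounds as TB.
exists (fun z => Cartanh (T (r * z)%C)); split; [| split; [| split]].
- intros z Hz; destruct HT as [T' HT]; destruct (HT _ (in_disk_scal r Hr1 z Hz)) as [D _].
  eexists; apply is_Cderive_is_derive.
  apply (is_Cderive_comp (fun z => T (r * z)%C) Cartanh).
  + apply (is_Cderive_comp (fun z => r * z)%C T); [apply is_Cderive_scal, is_Cderive_id | exact D].
  + apply is_Cderive_Cartanh; unfold in_disk; specialize (G z Hz); lra.
- intros z Hz; apply Cartanh_lt_1, G, Hz.
- replace (T (r * 0)%C) with (RtoC 0).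
  + unfold Cartanh; replace (1 + - 0)%C with (1 + 0)%C by ring; ring.
  + unfold T, q, starlike_quotient; destruct (Ceq_dec (r * 0) 0) as [_ | N]; [ring | exfalso; apply N; ring].
- intros z Hz; rewrite dilation_starlike_quotient by assumption; fold q.
  symmetry; destruct (G z Hz) as [G1 G2]; apply Bfun_Cartanh; [unfold in_disk; lra | unfold T; ring | exact G1].
Qed.

(** [Clog] only inverts the exponential on the right half-plane, so z is first divided by one of 1,
    -1, i, -i, each a known exponential. *)
Lemma Cexp_surjective (z : C) : z <> 0 -> exists s, Cexp s = z.
Proof.
intros N.
assert (P : forall u t : C, Cexp t = u -> 0 < Re (z / u)%C -> exists s, Cexp s = z).
{ intros u t E H; exists (Clog (z / u) + t)%C; rewrite Cexp_plus, Cexp_Clog, E by exact H.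
  field; rewrite <- E; apply Cexp_nonzero. }
assert (U : forall a, Cexp (0, a) = (cos a, sin a)).
{ intros a; unfold Cexp; simpl; rewrite exp_0; apply injective_projections; simpl; ring. }
destruct z as [x y].
destruct (Rtotal_order x 0) as [L | [L | L]].
- apply (P (- (1))%C (0, PI)); [rewrite U, cos_PI, sin_PI; apply injective_projections; simpl; ring |].
  replace ((x, y) / - (1))%C with (- (x, y))%C by (field; intros E; apply RtoC_inj in E; lra); simpl; lra.
- destruct (Rtotal_order y 0) as [M | [M | M]].
  + apply (P (- Ci)%C (0, - (PI / 2))); [rewrite U, cos_neg, sin_neg, cos_PI2, sin_PI2; apply injective_projections; simpl; ring |].
    replace ((x, y) / - Ci)%C with (Ci * (x, y))%C.
    * simpl; lra.
    * replace Ci with (- / Ci)%C at 1 by (rewrite Ci_inv; ring); field; exact Ci_nz.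
  + exfalso; apply N; subst; reflexivity.
  + apply (P Ci (0, PI / 2)); [rewrite U, cos_PI2, sin_PI2; reflexivity |].
    replace ((x, y) / Ci)%C with (- Ci * (x, y))%C by (rewrite <- Ci_inv; field; exact Ci_nz); simpl; lra.
- apply (P 1 0); [apply Cexp_0 |].
  replace ((x, y) / 1)%C with (1 * (x, y))%C by field; simpl; lra.
Qed.

Lemma Cexp_eq_1 s : Cexp s = 1 -> Re s = 0 /\ exists k : Z, Im s = 2 * (IZR k * PI).
Proof.
intros E.
assert (E1 : exp (Re s) * cos (Im s) = 1) by exact (f_equal fst E).
assert (E2 : Cmod (Cexp s) = 1) by (rewrite E; apply Cmod_1).
rewrite Cmod_Cexp in E2.
assert (R0 : Re s = 0) by (apply exp_inv; rewrite exp_0; exact E2).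
split; [exact R0 |]; rewrite R0, exp_0, Rmult_1_l in E1.
(* The identity cos (2 a) = 1 - 2 sin^2 a turns cos = 1 into a zero of the sine, whose zeros are
   known. *)
replace (Im s) with (2 * (Im s / 2)) in E1 by field; rewrite cos_2a_sin in E1.
destruct (sin_eq_0_0 (Im s / 2)) as [k Hk]; [nra |].
exists k; lra.
Qed.

Lemma Cexp_period (k : Z) : Cexp (0, 2 * (IZR k * PI)) = 1.
Proof.
unfold Cexp; simpl; rewrite exp_0, cos_2a_sin, sin_2a, sin_eq_0_1 by (exists k; reflexivity).
apply injective_projections; simpl; ring.
Qed.

(* Noshiro-Warschawski on the left half-plane, in the coordinate s = log z. *)
Lemma half_plane_injective (F F' : C -> C) s1 s2 :
  (forall s, Re s < 0 -> is_Cderive F s (F' s) /\ 0 < Re (F' s)) -> Re s1 < 0 -> Re s2 < 0 -> F s1 = F s2 -> s1 = s2.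
Proof.
intros H H1 H2 E; set (d := (s2 - s1)%C).
destruct (Ceq_dec d 0) as [Z | N].
{ replace s2 with (d + s1)%C by (unfold d; ring); rewrite Z; ring. }
exfalso.
assert (L : forall t, 0 <= t <= 1 -> Re (s1 + t * d)%C < 0).
{ intros t Ht; replace (Re (s1 + t * d)) with ((1 - t) * Re s1 + t * Re s2); [nra |].
  unfold d, Cminus; rewrite re_plus, re_scal_l, re_plus, re_opp; ring. }
assert (K : forall t, 0 <= t <= 1 -> is_derive (fun t : R => Re (Cconj d * F (s1 + t * d))%C) t (Cmod d ^ 2 * Re (F' (s1 + t * d)%C))).
{ intros t Ht.
  replace (Cmod d ^ 2 * Re (F' (s1 + t * d)%C)) with (Re (Cconj d * (F' (s1 + t * d) * d))%C).
  - apply (is_curve_derive_Re (fun t => Cconj d * F (s1 + t * d))%C), (is_curve_derive_scal _ (fun t => F (s1 + t * d)%C)).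
    apply (is_curve_derive_comp F (fun t => s1 + t * d)%C); [apply is_curve_derive_line | apply H, L, Ht].
  - rewrite <- re_scal_l, Cmod2_conj; f_equal; ring. }
destruct (MVT_gen (fun t => Re (Cconj d * F (s1 + t * d))%C) 0 1 (fun t => Cmod d ^ 2 * Re (F' (s1 + t * d)%C))) as [t [Ht M]].
{ rewrite Rmin_left, Rmax_right by lra; intros t Ht; apply K; lra. }
{ rewrite Rmin_left, Rmax_right by lra; intros t Ht; apply derivable_continuous_pt.
  exists (Cmod d ^ 2 * Re (F' (s1 + t * d)%C)); apply is_derive_Reals, K, Ht. }
rewrite Rmin_left, Rmax_right in Ht by lra.
replace (s1 + 1 * d)%C with s2 in M by (unfold d; ring); replace (s1 + 0 * d)%C with s1 in M by ring.
rewrite E, Rminus_diag_eq in M by reflexivity.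
pose proof (proj1 (Cmod_gt_0 d) N); pose proof (proj2 (H _ (L t Ht))).
assert (0 < Cmod d ^ 2 * Re (F' (s1 + t * d)%C)) by (apply Rmult_lt_0_compat; [apply pow_lt |]; assumption).
lra.
Qed.

(** Abel's lemma: boundedness of the terms at a radius between |z| and 1 gives a geometric majorant.
    Applied to the coefficients a k / (k + 1) of a primitive. *)
Lemma pseries_dominated (a b : nat -> C) f : (forall z, in_disk z -> is_Cseries (fun k => a k * z ^ k)%C (f z)) ->
  (forall k, Cmod (b k) <= Cmod (a k)) -> forall z, in_disk z -> exists l, is_Cseries (fun k => b k * z ^ k)%C l.
Proof.
intros H Hb z Hz; unfold in_disk in Hz; pose proof (Cmod_ge_0 z).
set (r := (1 + Cmod z) / 2); assert (Hr : 0 < r < 1 /\ Cmod z < r) by (unfold r; lra).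
destruct (is_Cseries_terms_bounded _ _ (H (RtoC r) ltac:(unfold in_disk; rewrite Cmod_R, Rabs_right; lra))) as [M [M0 HM]].
apply is_Cseries_majorant with (fun k => M * (Cmod z / r) ^ k).
- intros k; specialize (HM k); rewrite Cmod_mult, Cmod_pow, Cmod_R, Rabs_right in HM by lra.
  assert (P : 0 < r ^ k) by (apply pow_lt; lra).
  rewrite Cmod_mult, Cmod_pow; unfold Rdiv; rewrite Rpow_mult_distr, pow_inv.
  replace (M * (Cmod z ^ k * / r ^ k)) with (M / r ^ k * Cmod z ^ k) by (field; lra).
  apply Rmult_le_compat_r; [apply pow_le; lra |].
  apply Rle_trans with (Cmod (a k)); [apply Hb |].
  apply Rmult_le_reg_r with (r ^ k); [exact P |]; unfold Rdiv; rewrite Rmult_assoc, Rinv_l; lra.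
- apply (ex_series_scal_l (V := R_NormedModule) M), ex_series_geom.
  unfold Rdiv; rewrite Rabs_right; [apply Rmult_lt_reg_r with r; [lra |]; rewrite Rmult_assoc, Rinv_l; lra |].
  apply Rle_ge, Rmult_le_pos; [lra | apply Rlt_le, Rinv_0_lt_compat; lra].
Qed.

Lemma holomorphic_primitive p : holomorphic p -> exists h, holomorphic h /\ h 0 = 0 /\ forall z, in_disk z -> is_Cderive h z (p z).
Proof.
intros Hp; destruct (holomorphic_taylor p Hp) as [a Ha].
set (b := fun k => match k with O => RtoC 0 | S k => (a k / INR (S k))%C end).
assert (NZ : forall k, RtoC (INR (S k)) <> 0) by (intros k E; apply RtoC_inj in E; pose proof (lt_0_INR (S k) ltac:(lia)); lra).
assert (Hb : forall z, in_disk z -> exists l, is_Cseries (fun k => b k * z ^ k)%C l).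
{ intros z Hz; destruct (pseries_dominated a (fun k => b (S k)) p Ha) with (z := z) as [l Hl]; [| exact Hz |].
  - intros k; unfold b; rewrite Cmod_div by apply NZ; rewrite Cmod_R, Rabs_right by (apply Rle_ge, pos_INR).
    pose proof (Cmod_ge_0 (a k)); apply Rmult_le_reg_r with (INR (S k)); [apply lt_0_INR; lia |].
    unfold Rdiv; rewrite Rmult_assoc, Rinv_l by (apply not_0_INR; lia).
    rewrite S_INR; pose proof (pos_INR k); nra.
  - exists (z * l)%C; apply is_Cseries_shift; simpl.
    replace (z * l - 0 * 1)%C with (z * l)%C by ring.
    apply is_Cseries_ext with (fun k => z * (b (S k) * z ^ k))%C; [intros k; simpl; ring | apply is_Cseries_scal, Hl]. }
(* A sum exists for each z in the disk and is unique, so [iota] selects it; values outside the disk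
   are irrelevant. *)
set (h := fun z => iota (fun l : C_CompleteNormedModule => is_Cseries (fun k => b k * z ^ k)%C l)).
assert (Hh : forall z, in_disk z -> is_Cseries (fun k => b k * z ^ k)%C (h z)).
{ intros z Hz; destruct (Hb z Hz) as [l Hl].
  apply (iota_correct (V := C_CompleteNormedModule) (fun l => is_Cseries (fun k => b k * z ^ k)%C l)).
  exists l; split; [exact Hl |]; intros l' Hl'; exact (is_Cseries_unique _ _ _ Hl Hl'). }
exists h; split; [exact (pseries_holomorphic b h Hh) | split].
- rewrite <- (pseries_value_0 b h Hh); reflexivity.
- intros z Hz; destruct (pseries_C_derive b h Hh z Hz) as [D1 D2].
  replace (p z) with (C_derive h z); [exact D1 |].
  apply (is_Cseries_unique _ _ _ D2); apply is_Cseries_ext with (fun k => a k * z ^ k)%C; [| apply Ha, Hz].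
  intros k; unfold b; field; apply NZ.
Qed.

Lemma starlike_extremal (psi : C -> C) : holomorphic psi -> psi 0 = 1 -> (forall z, in_disk z -> 0 < Re (psi z)) ->
  exists f, Sstar psi f /\ forall z, in_disk z -> starlike_quotient f z = psi z.
Proof.
intros Hpsi P0 Ppos.
destruct (holomorphic_taylor _ (holomorphic_plus _ _ Hpsi (holomorphic_const (- (1))))) as [a Ha].
assert (A0 : a 0%nat = 0).
{ rewrite (pseries_value_0 a _ Ha), P0; ring. }
set (p := fun z => if Ceq_dec z 0 then a 1%nat else ((psi z + - (1)) / z)%C).
assert (Hp : holomorphic p).
{ apply (pseries_holomorphic (fun k => a (S k))); intros z Hz; apply (pseries_div a (fun z => psi z + - (1))%C); [exact A0 | apply Ha, Hz]. }
assert (Ep : forall z, (1 + z * p z)%C = psi z).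
{ intros z; unfold p; destruct (Ceq_dec z 0) as [-> | N]; [rewrite P0; ring | field; exact N]. }
destruct (holomorphic_primitive p Hp) as [h [Hh [H0 Dh]]].
set (f := fun z => (z * Cexp (h z))%C).
assert (Hf : holomorphic f) by (apply holomorphic_mult; [apply holomorphic_id | apply holomorphic_Cexp, Hh]).
assert (Df : forall z, in_disk z -> is_Cderive f z (Cexp (h z) * psi z)).
{ intros z Hz; rewrite <- Ep; replace (Cexp (h z) * (1 + z * p z))%C with (1 * Cexp (h z) + z * (Cexp (h z) * p z))%C by ring.
  apply (is_Cderive_mult (fun z => z) (fun z => Cexp (h z))); [apply is_Cderive_id |].
  apply (is_Cderive_comp h Cexp); [apply Dh, Hz | apply is_Cderive_Cexp]. }
assert (Qf : forall z, in_disk z -> starlike_quotient f z = psi z).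
{ intros z Hz; unfold starlike_quotient; destruct (Ceq_dec z 0) as [-> | N]; [symmetry; exact P0 |].
  rewrite (is_C_derive_unique _ _ _ (proj1 (is_Cderive_is_derive _ _ _) (Df z Hz))); unfold f.
  field; split; [apply Cexp_nonzero | exact N]. }
exists f; split; [| exact Qf]; split; [split |].
- split; [apply holomorphic_analytic, Hf |].
  destruct (holomorphic_taylor f Hf) as [c Hc]; exists c; split; [| split].
  + rewrite (pseries_value_0 c f Hc); unfold f; ring.
  (* The coefficient c 1 is the value at 0 of the derived series, and f'(0) = exp (h 0) psi 0 =
     1. *)
  + destruct (pseries_C_derive c f Hc 0 in_disk_0) as [D1 D2].
    pose proof (is_Cderive_unique _ _ _ _ D1 (Df 0 in_disk_0)) as E; rewrite H0, Cexp_0, P0 in E; rewrite E in D2.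
    transitivity (INR 1 * c 1%nat)%C; [simpl; ring |].
    transitivity (1 * 1)%C; [| ring].
    apply (is_Cseries_unique _ _ _ (is_Cseries_at_0 (fun k => INR (S k) * c (S k))%C) D2).
  + intros z Hz; apply is_pseries_is_Cseries, Hc, Hz.
- assert (F0 : forall z : C, z <> 0 -> f z <> 0) by (intros z N; apply Cmult_neq_0; [exact N | apply Cexp_nonzero]).
  assert (Ff : f 0 = 0) by (unfold f; ring).
  intros z1 z2 Z1 Z2 E.
  destruct (Ceq_dec z1 0) as [E1 | N1].
  { subst z1; destruct (Ceq_dec z2 0) as [E2 | N2]; [symmetry; exact E2 |].
    exfalso; apply (F0 z2 N2); rewrite <- E; exact Ff. }
  destruct (Ceq_dec z2 0) as [E2 | N2].
  { subst z2; exfalso; apply (F0 z1 N1); rewrite E; exact Ff. }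
  destruct (Cexp_surjective z1 N1) as [s1 S1], (Cexp_surjective z2 N2) as [s2 S2].
  (* A logarithm of f in the coordinate s: f (z1) = f (z2) says that F s1 and F s2 differ by a
     multiple of 2 pi i. *)
  set (F := fun s => (s + h (Cexp s))%C).
  assert (EF : forall s, Cexp (F s) = f (Cexp s)) by (intros s; unfold F, f; apply Cexp_plus).
  assert (D : Cexp (F s1 - F s2) = 1).
  { unfold Cminus; rewrite Cexp_plus, Cexp_opp, !EF, S1, S2, E; field; apply F0, N2. }
  destruct (Cexp_eq_1 _ D) as [R0 [k Hk]].
  (* Shifting s2 by this period leaves z2 and h (z2) unchanged and makes the two values of F
     equal. *)
  set (tau := (0, 2 * (IZR k * PI)) : C).
  assert (S2' : Cexp (s2 + tau) = z2) by (rewrite Cexp_plus; unfold tau; rewrite Cexp_period, S2; ring).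
  rewrite <- S1, <- S2'; f_equal.
  assert (Neg : forall s, in_disk (Cexp s) <-> Re s < 0).
  { intros s; unfold in_disk; rewrite Cmod_Cexp, <- exp_0; split; [apply exp_lt_inv | apply exp_increasing]. }
  apply (half_plane_injective F (fun s => psi (Cexp s))).
  + intros s Hs; apply Neg in Hs; split; [| apply Ppos, Hs].
    rewrite <- Ep; replace (1 + Cexp s * p (Cexp s))%C with (1 + p (Cexp s) * Cexp s)%C by ring.
    apply is_Cderive_plus; [apply is_Cderive_id |]; apply (is_Cderive_comp Cexp h); [apply is_Cderive_Cexp | apply Dh, Hs].
  + apply Neg; rewrite S1; exact Z1.
  + apply Neg; rewrite S2'; exact Z2.
  + assert (T : (F s1 - F s2)%C = tau) by (apply injective_projections; [exact R0 | exact Hk]).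
    replace (F s1) with (F s1 - F s2 + F s2)%C by ring; rewrite T; unfold F; rewrite S2', S2; ring.
(* The starlike quotient is psi itself, so the identity is the subordinating function. *)
- exists (fun z => z); split; [apply holomorphic_analytic, holomorphic_id |]; split; [auto |]; split; [reflexivity | exact Qf].
Qed.

(** If rho < rho', the point s rho / rho' lies in the disk, and there the dilated extremal function
    has quotient psi (s rho), an endpoint value that [Bfun_avoids] excludes. *)
Lemma radius_upper_bound (psi : C -> C) (rho s rho' : R) :
  holomorphic psi -> psi 0 = 1 -> (forall z, in_disk z -> 0 < Re (psi z)) ->
  0 < rho -> s = 1 \/ s = -1 -> (psi (RtoC (s * rho)) * psi (RtoC (s * rho)))%C = RtoC (1 + s * tanh1) ->
  admissible_radius (Sstar psi) rho' -> rho' <= rho.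
Proof.
intros Hpsi P0 Ppos Hrho Hs E [Hr' A]; apply Rnot_lt_le; intros L.
destruct (starlike_extremal psi Hpsi P0 Ppos) as [f [Sf Qf]].
destruct (A f Sf rho' ltac:(lra)) as [_ [v [_ [V2 [_ V4]]]]].
assert (As : Rabs s = 1) by (destruct Hs as [-> | ->]; unfold Rabs; destruct Rcase_abs; lra).
set (z := RtoC (s * rho / rho')).
assert (Hz : in_disk z).
{ unfold in_disk, z; rewrite Cmod_R; unfold Rdiv; rewrite !Rabs_mult, As, !Rabs_right by (try (apply Rle_ge, Rlt_le, Rinv_0_lt_compat); lra).
  apply Rmult_lt_reg_r with rho'; [lra |]; rewrite Rmult_assoc, Rinv_l; lra. }
assert (Ez : (rho' * z)%C = RtoC (s * rho)) by (unfold z; rewrite <- RtoC_mult; f_equal; field; lra).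
specialize (V4 z Hz); rewrite dilation_starlike_quotient in V4 by (try apply Sf; assumption).
rewrite Ez, Qf in V4 by (unfold in_disk; rewrite Cmod_R, Rabs_mult, As, Rabs_right; lra).
apply (Bfun_avoids (v z) s (V2 z Hz) Hs); rewrite <- V4; exact E.
Qed.

(** * The two radii *)

Lemma holomorphic_Clog_1_plus : holomorphic (fun z => Clog (1 + z)).
Proof.
exists (fun z => / (1 + z) * (0 + 1))%C; intros z Hz; split.
- apply (is_Cderive_comp (fun z => 1 + z)%C Clog); [apply is_Cderive_plus; [apply is_Cderive_const | apply is_Cderive_id] | apply is_Cderive_Clog, Re_1_plus, Hz].
- apply Ccontinuous_mult; [| apply Ccontinuous_const]; apply Ccontinuous_inv; [| apply one_plus_nonzero, Hz].
  apply Ccontinuous_plus; [apply Ccontinuous_const | apply Ccontinuous_id].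
Qed.

Lemma holomorphic_Csqrt_1_plus : holomorphic (fun z => Csqrt (1 + z)).
Proof.
apply holomorphic_ext with (fun z => Cexp (/ 2 * Clog (1 + z))).
- intros z Hz; symmetry; apply Csqrt_exp_log, Hz.
- apply holomorphic_Cexp, (holomorphic_scal (/ 2) (fun z => Clog (1 + z))), holomorphic_Clog_1_plus.
Qed.

Lemma holomorphic_affine (a b : C) f : holomorphic f -> holomorphic (fun z => a + b * f z)%C.
Proof. intros H; apply (holomorphic_plus (fun _ => a)); [apply holomorphic_const | apply holomorphic_scal, H]. Qed.

Lemma holomorphic_affine_inv (a b : C) f : b <> 0 -> holomorphic (fun z => a + b * f z)%C -> holomorphic f.
Proof.
intros Hb H; apply holomorphic_ext with (2 := holomorphic_affine (- a / b) (/ b) _ H).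
intros z _; field; exact Hb.
Qed.

(** No logarithm is taken: w is already differentiable, and w' = (exp w)' / exp w shows that its
    derivative is continuous. *)
Lemma holomorphic_log w : analytic_on_disk w -> holomorphic (fun z => Cexp (w z)) -> holomorphic w.
Proof.
intros Hw [p' Hp]; exists (fun z => p' z * / Cexp (w z))%C; intros z Hz; destruct (Hp z Hz) as [A B].
destruct (Hw z Hz) as [l Hl]; change C in (type of l); apply is_Cderive_is_derive in Hl; split.
- replace (p' z * / Cexp (w z))%C with l; [exact Hl |].
  rewrite (is_Cderive_unique _ _ _ _ A (is_Cderive_comp w Cexp _ _ _ Hl (is_Cderive_Cexp (w z)))); field; apply Cexp_nonzero.
- apply Ccontinuous_mult; [exact B |]; apply Ccontinuous_inv; [exact (is_Cderive_Ccontinuous _ _ _ A) | apply Cexp_nonzero].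
Qed.

Lemma RtoC_1_minus_nonzero (alpha : R) : alpha < 1 -> (1 - alpha)%C <> 0.
Proof. intros H E; rewrite <- RtoC_minus in E; apply RtoC_inj in E; lra. Qed.

(* With x = s - 1, the Cassini-type bound on |x (x + 2)| gives |x| <= tau, and 2 + b x = 2 (1 - b) + b (x + 2). *)
Lemma cassini_contraction (x : C) (b tau : R) : 0 < b <= 1 -> 0 < tau <= 1 -> - 1 < Re x ->
  Cmod (x * (x + 2)) < tau * (2 - tau) -> Cmod (b * x * (2 + b * x)) < b * tau * (2 - b * tau).
Proof.
intros Hb Ht Hx H; rewrite Cmod_mult in H.
set (X := Cmod x) in *; set (Y := Cmod (x + 2)) in *.
pose proof (Cmod_ge_0 x : 0 <= X) as X0; pose proof (Cmod_ge_0 (x + 2) : 0 <= Y) as Y0.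
assert (Y1 : 2 <= X + Y).
{ pose proof (Cmod_triangle (- x) (x + 2)) as T; rewrite Cmod_opp in T.
  replace (- x + (x + 2))%C with (RtoC 2) in T by ring; rewrite Cmod_R, Rabs_right in T by lra; exact T. }
assert (Y2 : X ^ 2 <= Y ^ 2).
{ unfold X, Y; rewrite !Cmod2_alt, re_plus, im_plus; simpl; unfold Re in *; nra. }
assert (Y3 : X <= Y) by (apply Rsqr_incr_0_var; [unfold Rsqr; lra | exact Y0]).
assert (X1 : X <= tau).
{ apply Rnot_lt_le; intros L.
  assert (X * X <= X * Y) by (apply Rmult_le_compat_l; assumption).
  assert (X * (2 - X) <= X * Y) by (apply Rmult_le_compat_l; lra).
  assert (X < 1) by nra; nra. }
assert (E : Cmod (2 + b * x) <= 2 * (1 - b) + b * Y).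
{ replace (2 + b * x)%C with (RtoC (2 * (1 - b)) + b * (x + 2))%C by (rewrite RtoC_mult, RtoC_minus; ring).
  eapply Rle_trans; [apply Cmod_triangle |]; rewrite Cmod_mult, !Cmod_R, !Rabs_right by lra; apply Rle_refl. }
rewrite !Cmod_mult, Cmod_R, Rabs_right by lra; fold X.
apply Rle_lt_trans with (b * X * (2 * (1 - b) + b * Y)); [apply Rmult_le_compat_l; [nra | exact E] |].
replace (b * X * (2 * (1 - b) + b * Y)) with (b * (2 * (1 - b) * X + b * (X * Y))) by ring.
replace (b * tau * (2 - b * tau)) with (b * (2 * (1 - b) * tau + b * (tau * (2 - tau)))) by ring.
apply Rmult_lt_compat_l; [lra |].
assert (2 * (1 - b) * X <= 2 * (1 - b) * tau) by (apply Rmult_le_compat_l; lra).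
assert (b * (X * Y) < b * (tau * (2 - tau))) by (apply Rmult_lt_compat_l; lra).
lra.
Qed.

Lemma Bfun_endpoint_values (m := sqrt (2 / (1 + exp 1 ^ 2))) :
  0 < m < 1 /\ 1 < exp 1 * m < 2 /\ m * m = 1 - tanh1 /\ (exp 1 * m) * (exp 1 * m) = 1 + tanh1.
Proof.
pose proof (exp_ineq1 1 ltac:(lra)) as E; pose proof tanh1_bounds as TB.
assert (P : 0 < 2 / (1 + exp 1 ^ 2)) by (apply Rdiv_lt_0_compat; nra).
assert (M0 : 0 < m) by (apply sqrt_lt_R0, P).
assert (M2 : m * m = 2 / (1 + exp 1 ^ 2)) by (apply sqrt_sqrt; lra).
assert (M3 : m * m = 1 - tanh1) by (rewrite M2; unfold tanh1; field; nra).
assert (M4 : (exp 1 * m) * (exp 1 * m) = 1 + tanh1).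
{ replace (exp 1 * m * (exp 1 * m)) with (exp 1 * exp 1 * (m * m)) by ring; rewrite M2; unfold tanh1; field; nra. }
assert (M5 : 0 < exp 1 * m) by (apply Rmult_lt_0_compat; lra).
repeat split; try assumption; nra.
Qed.

Lemma lemniscate_radius (alpha : R) :
  0 <= alpha < 1 - exp 1 / sqrt (2 * (1 + exp 1 ^ 2)) ->
  is_SstarB_radius (SstarL alpha) (1 - ((sqrt (2 / (1 + exp 1 ^ 2)) - alpha) / (1 - alpha)) ^ 2).
Proof.
intros Ha.
pose proof Bfun_endpoint_values as K; cbv zeta in K; set (m := sqrt (2 / (1 + exp 1 ^ 2))) in *.
destruct K as [M1 [M2 [M3 M4]]].
pose proof (exp_ineq1 1 ltac:(lra)) as E1; pose proof exp_le_3 as E3; pose proof tanh1_bounds as TB.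
assert (E2 : 4 < exp 1 ^ 2) by nra.
assert (Ham : alpha < m).
(* The hypothesis reads alpha < 1 - e m / 2, which implies alpha < m as soon as m (2 + e) > 2. *)
{ assert (Q : exp 1 / sqrt (2 * (1 + exp 1 ^ 2)) = exp 1 * m / 2).
  { assert (S0 : 0 < sqrt (2 * (1 + exp 1 ^ 2))) by (apply sqrt_lt_R0; lra).
    assert (S : m = 2 / sqrt (2 * (1 + exp 1 ^ 2))).
    { unfold m; apply sqrt_lem_1; [apply Rlt_le, Rdiv_lt_0_compat; lra | apply Rlt_le, Rdiv_lt_0_compat; lra |].
      transitivity (4 / (sqrt (2 * (1 + exp 1 ^ 2)) * sqrt (2 * (1 + exp 1 ^ 2)))); [field; lra |].
      rewrite sqrt_sqrt by lra; field; lra. }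
    rewrite S; field; lra. }
  rewrite Q in Ha.
  (* After squaring and clearing denominators this is e^2 < 4 e + 2, which follows from e <= 3. *)
  assert (4 < (m * (2 + exp 1)) * (m * (2 + exp 1))).
  { replace (m * (2 + exp 1) * (m * (2 + exp 1))) with (m * m * ((2 + exp 1) * (2 + exp 1))) by ring.
    unfold tanh1 in M3; rewrite M3; apply Rmult_lt_reg_r with (exp 1 ^ 2 + 1); [nra |].
    replace ((1 - (exp 1 ^ 2 - 1) / (exp 1 ^ 2 + 1)) * ((2 + exp 1) * (2 + exp 1)) * (exp 1 ^ 2 + 1))
      with (2 * ((2 + exp 1) * (2 + exp 1))) by (field; nra).
    nra. }
  assert (2 < m * (2 + exp 1)) by nra; lra. }
(* This is sqrt (1 - rho) for the announced radius rho, so psi (-rho) = alpha + (1 - alpha) t =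
   m. *)
set (t := (m - alpha) / (1 - alpha)).
assert (Et : (1 - alpha) * (1 - t) = 1 - m) by (unfold t; field; lra).
assert (T0 : 0 < t) by (apply Rdiv_lt_0_compat; lra).
assert (T1 : t < 1) by nra.
assert (Hrho : 0 < 1 - t ^ 2 <= 1) by nra.
set (psi := fun z : C => (alpha + (1 - alpha) * Csqrt (1 + z))%C).
assert (NA : (1 - alpha)%C <> 0) by (apply RtoC_1_minus_nonzero; lra).
assert (Hpsi : holomorphic psi) by (apply holomorphic_affine, holomorphic_Csqrt_1_plus).
assert (Ppos : forall z, in_disk z -> 0 < Re (psi z)).
{ intros z Hz; pose proof (Re_Csqrt_1_plus z Hz) as S; unfold psi; rewrite <- RtoC_minus, re_plus, re_scal_l.
  change (Re (RtoC alpha)) with alpha.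
  assert (0 < (1 - alpha) * Re (Csqrt (1 + z))) by (apply Rmult_lt_0_compat; lra); lra. }
split.
- apply tanh_disk_admissible; [exact Hrho | |].
  (* w is the square of sqrt (1 + w) minus 1. *)
  + intros w _ _ H; apply holomorphic_affine_inv in H; [| exact NA].
    apply holomorphic_ext with (2 := holomorphic_plus _ _ (holomorphic_const (- (1))) (holomorphic_mult _ _ H H)).
    intros z _; rewrite (proj1 (Csqrt_spec _)); ring.
  + intros z Hz; assert (Hz1 : in_disk z) by (unfold in_disk; lra).
    split; [apply Ppos, Hz1 |].
    set (x := (Csqrt (1 + z) - 1)%C).
    assert (Ex : (x * (x + 2))%C = z).
    { unfold x; transitivity (Csqrt (1 + z) * Csqrt (1 + z) - 1)%C; [ring | rewrite (proj1 (Csqrt_spec _)); ring]. }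
    replace ((alpha + (1 - alpha) * Csqrt (1 + z)) * (alpha + (1 - alpha) * Csqrt (1 + z)) - 1)%C
      with (RtoC (1 - alpha) * x * (2 + RtoC (1 - alpha) * x))%C by (unfold x; rewrite RtoC_minus; ring).
    (* With b = 1 - alpha and tau = 1 - t one has b tau = 1 - m, so b tau (2 - b tau) = 1 - m^2 =
       tanh 1. Moreover tau (2 - tau) = 1 - t^2 is the radius, and x (x + 2) = z. *)
    replace tanh1 with ((1 - alpha) * (1 - t) * (2 - (1 - alpha) * (1 - t))) by (rewrite Et; lra).
    apply cassini_contraction; [lra | lra | | rewrite Ex; lra].
    pose proof (Re_Csqrt_1_plus z Hz1); unfold x, Cminus; rewrite re_plus, re_opp; change (Re (RtoC 1)) with 1; lra.
- intros rho' H; apply (radius_upper_bound psi _ (-1)); try assumption; [| lra | right; reflexivity |].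
  + unfold psi; rewrite (Csqrt_unique 1); [ring | ring | simpl; lra].
  + assert (V : psi (RtoC (-1 * (1 - t ^ 2))) = RtoC m).
    { unfold psi; rewrite (Csqrt_unique (RtoC t)); [| | simpl; lra].
      - replace m with (alpha + (1 - alpha) * t) by (unfold t; field; lra).
        rewrite RtoC_plus, RtoC_mult, RtoC_minus; reflexivity.
      - rewrite <- RtoC_mult, <- RtoC_plus; f_equal; ring. }
    rewrite V, <- RtoC_mult, M3; f_equal; ring.
Qed.

(** The quotient under the logarithm grows without bound as alpha tends to 1; once it reaches e, the
    whole class lies in the target class and the radius is 1. *)
Lemma exponential_radius (alpha : R) : 0 <= alpha < 1 ->
  is_SstarB_radius (Sstare alpha)
    (Rmin 1 (ln ((exp 1 * sqrt (2 / (1 + exp 1 ^ 2)) - alpha) / (1 - alpha)))).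
Proof.
intros Ha.
pose proof Bfun_endpoint_values as K; cbv zeta in K; set (m := sqrt (2 / (1 + exp 1 ^ 2))) in *.
destruct K as [M1 [M2 [M3 M4]]]; set (M := exp 1 * m) in *.
set (k := (M - alpha) / (1 - alpha)).
assert (Ek : (1 - alpha) * (k - 1) = M - 1) by (unfold k; field; lra).
assert (K1 : 1 < k) by nra.
assert (L0 : 0 < ln k) by (rewrite <- ln_1; apply ln_increasing; lra).
set (psi := fun z : C => (alpha + (1 - alpha) * Cexp z)%C).
assert (NA : (1 - alpha)%C <> 0) by (apply RtoC_1_minus_nonzero; lra).
assert (Hpsi : holomorphic psi) by (apply holomorphic_affine, holomorphic_Cexp, holomorphic_id).
assert (R0 : 0 < Rmin 1 (ln k) <= 1) by (split; [apply Rmin_glb_lt; lra | apply Rmin_l]).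
split.
- apply tanh_disk_admissible; [exact R0 | |].
  + intros w Hw _ H; apply holomorphic_affine_inv in H; [| exact NA]; exact (holomorphic_log w Hw H).
  + intros z Hz; change (0 < Re (psi z) /\ Cmod (psi z * psi z - 1) < tanh1).
    (* This disk suffices: |psi^2 - 1| <= |psi - 1| (|psi - 1| + 2) < (M - 1) (M + 1) = tanh 1, and
       Re psi > 0 because M < 2. *)
    assert (D : Cmod (psi z - 1) < M - 1).
    { replace (psi z - 1)%C with (RtoC (1 - alpha) * (Cexp z - 1))%C by (unfold psi; rewrite RtoC_minus; ring).
      rewrite Cmod_mult, Cmod_R, Rabs_right, <- Ek by lra; apply Rmult_lt_compat_l; [lra |].
      eapply Rle_lt_trans; [apply Cmod_Cexp_minus_1 |].
      assert (exp (Cmod z) < k); [| lra].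
      rewrite <- (exp_ln k) by lra; apply exp_increasing; pose proof (Rmin_r 1 (ln k)); lra. }
    split.
    * pose proof (Re_bounds (psi z - 1)) as B; unfold Cminus in B; rewrite re_plus, re_opp in B; change (Re (RtoC 1)) with 1 in B.
      unfold Cminus in D; lra.
    * replace (psi z * psi z - 1)%C with ((psi z - 1) * (psi z - 1 + 2))%C by ring.
      rewrite Cmod_mult; pose proof (Cmod_triangle (psi z - 1) 2) as T; rewrite (Cmod_R 2), (Rabs_right 2) in T by lra.
      pose proof (Cmod_ge_0 (psi z - 1)); pose proof (Cmod_ge_0 (psi z - 1 + 2)); nra.
(* When the minimum is 1, maximality is part of admissibility; the extremal function is needed only
   for ln k < 1. *)
- intros rho' H; destruct (Rle_lt_dec 1 (ln k)) as [L | L]; [rewrite Rmin_left by exact L; apply H |].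
  rewrite Rmin_right by lra.
  apply (radius_upper_bound psi _ 1); try assumption; [| | left; reflexivity |].
  + unfold psi; rewrite Cexp_0; ring.
  (* Positivity of Re exp on the disk comes from |Im z| < 1 < pi/2. *)
  + intros z Hz; unfold psi; rewrite <- RtoC_minus, re_plus, re_scal_l; simpl.
    assert (0 < exp (fst z) * cos (snd z)).
    { apply Rmult_lt_0_compat; [apply exp_pos |].
      pose proof (im_le_Cmod z) as B; unfold in_disk in Hz; unfold Im in B; pose proof PI2_1.
      apply cos_gt_0; unfold Rabs in B; destruct Rcase_abs in B; lra. }
    assert (0 < (1 - alpha) * (exp (fst z) * cos (snd z))) by (apply Rmult_lt_0_compat; lra).
    unfold Re, Im; lra.
  + assert (V : psi (RtoC (1 * ln k)) = RtoC M).
    { unfold psi; rewrite Rmult_1_l, Cexp_R, exp_ln by lra.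
      rewrite <- RtoC_minus, <- RtoC_mult, <- RtoC_plus; f_equal; lra. }
    rewrite V, <- RtoC_mult, M4; f_equal; ring.
Qed.

Theorem theorem4p5 :
  (forall alpha : R,
     0 <= alpha < 1 - exp 1 / sqrt (2 * (1 + exp 1 ^ 2)) ->
     is_SstarB_radius (SstarL alpha)
       (1 - ((sqrt (2 / (1 + exp 1 ^ 2)) - alpha) / (1 - alpha)) ^ 2)) /\
  (forall alpha : R,
     0 <= alpha < 1 ->
     is_SstarB_radius (Sstare alpha)
       (Rmin 1 (ln ((exp 1 * sqrt (2 / (1 + exp 1 ^ 2)) - alpha) / (1 - alpha))))).
Proof.
split; [exact lemniscate_radius | exact exponential_radius].
Qed.
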